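(* There is a computable function $N:\mathbb{N}\to\mathbb{N}$ such that the following holds: if a finite simple graph $G$ is zero-forcing for a finite abelian group $\mathcal G$, but none of its proper induced subgraphs is zero-forcing for $\mathcal G$, then $|V(G)|\leq N(|\mathcal G|)$. In particular, the set $Z^{\mathrm{i}}(\mathcal G)$ is computable (from $\mathcal G$).
   Context: A $\mathcal G$-labeling of $G$ is a map $\ell: V(G)\to\mathcal G$, extended by $\ell(A)=\sum_{x\in A}\ell(x)$. A set $A\subseteq V(G)$ is connected if $G[A]$ is connected. $(G,\ell)$ is zero-avoiding if $\ell(A)\neq0$ for every non-empty connected $A\subseteq V(G)$. $G$ is zero-forcing for $\mathcal G$ if no $\mathcal G$-labeling $\ell$ makes $(G,\ell)$ zero-avoiding. $Z^{\mathrm{i}}(\mathcal G)$ denotes the set (up to isomorphism) of all graphs which are zero-forcing for $\mathcal G$ but none of whose proper induced subgraphs is zero-forcing for $\mathcal G$. *)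

(* Defs.v *)
From HB Require Import structures.
From mathcomp Require Import all_boot all_order all_algebra.

Set Implicit Arguments.
Unset Strict Implicit.
Unset Printing Implicit Defensive.

(* The total recursive functions: minimization is applied only to regular
   functions (those for which a zero always exists), so that all members of
   the class are total. In a primitive recursion, the first argument is the
   recursion variable and the step function receives it, then the previous
   value, then the parameters. *)
Inductive recursive : forall n : nat, (n.-tuple nat -> nat) -> Prop :=
| rec_zero n : @recursive n (fun=> 0)
| rec_succ : @recursive 1 (fun v => (thead v).+1)
| rec_proj n (i : 'I_n) : @recursive n (fun v => tnth v i)
| rec_comp n m (f : m.-tuple nat -> nat) (g : 'I_m -> n.-tuple nat -> nat) :
    recursive f -> (forall i, recursive (g i)) ->
    @recursive n (fun v => f [tuple g i v | i < m])
| rec_prec n (f : n.-tuple nat -> nat) (g : n.+2.-tuple nat -> nat) :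
    recursive f -> recursive g ->
    @recursive n.+1 (fun v =>
      iteri (thead v) (fun k r => g [tuple of k :: r :: behead_tuple v])
        (f (behead_tuple v)))
| rec_mu n (f : n.+1.-tuple nat -> nat)
    (regular_f : forall v : n.-tuple nat, exists k, f [tuple of k :: v] == 0) :
    recursive f -> @recursive n (fun v => ex_minn (regular_f v))
| rec_ext n (f g : n.-tuple nat -> nat) :
    f =1 g -> recursive f -> recursive g.

(* Used only for types built from nat by seq and pairs, whose pickle function
   is the standard coding: the identity on nat, CodeSeq.code on sequences of
   codes, and pairs coded as sequences of length 2. *)
Definition computable (A B : countType) (f : A -> B) : Prop :=
  exists h : nat -> nat,
    @recursive 1 (fun v => h (thead v)) /\
    forall a, h (pickle a) = pickle (f a).

Record sgraph := SGraph {
  vertex :> finType;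
  adj : rel vertex;
  adj_sym : symmetric adj;
  adj_irr : irreflexive adj }.

Section InducedSubgraph.
Variables (G : sgraph) (S : {set G}).

Definition induced_adj : rel {x : G | x \in S} :=
  [rel x y | adj (val x) (val y)].

Fact induced_sym : symmetric induced_adj.
Proof. by move=> x y; apply: adj_sym. Qed.

Fact induced_irr : irreflexive induced_adj.
Proof. by move=> x; apply: adj_irr. Qed.

Definition induced : sgraph := SGraph induced_sym induced_irr.
End InducedSubgraph.

Definition connected_graph (G : sgraph) : Prop :=
  forall x y : G, connect (@adj G) x y.

Definition connected_set (G : sgraph) (S : {set G}) : Prop :=
  connected_graph (induced S).

Definition zero_avoiding (A : finZmodType) (G : sgraph) (l : G -> A) : Prop :=
  forall S : {set G}, S != set0 -> connected_set S ->
    (\sum_(x in S) l x)%R <> 0%R.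

Definition zero_forcing (A : finZmodType) (G : sgraph) : Prop :=
  ~ exists l : G -> A, zero_avoiding l.

(* Membership in Z^i(A). *)
Definition induced_minimal (A : finZmodType) (G : sgraph) : Prop :=
  zero_forcing A G /\
  forall S : {set G}, S \proper [set: G] -> ~ zero_forcing A (induced S).

Definition isomorphic (G H : sgraph) : Prop :=
  exists f : G -> H, bijective f /\ forall x y, adj (f x) (f y) = adj x y.

(* (n, E) presents the graph on {0, ..., n - 1} with edge list E; loops,
   pairs out of range, order and repetitions in E are immaterial. *)
Notation graph_data := (nat * seq (nat * nat))%type.

Section GraphOfData.
Variable d : graph_data.

Definition data_adj : rel 'I_d.1 :=
  fun i j => (i != j) &&
    (((i : nat, j : nat) \in d.2) || ((j : nat, i : nat) \in d.2)).

Fact data_sym : symmetric data_adj.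
Proof. by move=> i j; rewrite /data_adj /= eq_sym orbC. Qed.

Fact data_irr : irreflexive data_adj.
Proof. by move=> i; rewrite /data_adj /= eqxx. Qed.

Definition graph_of_data : sgraph := SGraph data_sym data_irr.
End GraphOfData.

(* The isomorphism classes of graphs satisfying P are exactly those of the
   graphs listed in L, each class being listed once. *)
Definition lists_up_to_iso (L : seq graph_data) (P : sgraph -> Prop) : Prop :=
  (forall G : sgraph,
     P G <-> exists2 d, d \in L & isomorphic G (graph_of_data d)) /\
  (forall i j, i < j < size L ->
     ~ isomorphic (graph_of_data (nth (0, [::]) L i))
                  (graph_of_data (nth (0, [::]) L j))).

(* The addition table of A, elements being named by their position in the
   enumeration s. *)
Definition cayley_table (A : finZmodType) (s : seq A) : seq (seq nat) :=
  [seq [seq index (x + y)%R s | y <- s] | x <- s].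

(* Main.v *)
(* Every set carrying a path is connected, so partial sums along a path with
   [#|A|] vertices yield a zero-sum connected set; hence a minimal zero-forcing
   graph [G] with more than [#|A|.+1] vertices has no such path.  For a set [X]
   of vertices, a component [C] of [G - X] influences the rest of [G] only
   through the pairs (neighbourhoods in [X] of the components of [S], sum of
   the labels on [S]) for [S \subset C].  There are boundedly many families of
   such pairs, so if [G - X] had too many components one of them could be
   deleted without destroying the zero-forcing property.  Bounded path length
   and bounded numbers of components bound [G], by depth-first search.
   The list of minimal graphs is then found by a bounded search, all of whose
   tests are bounded quantifications over numbers coding sets, labellings and
   bijections. *)
Require Import Defs.
From HB Require Import structures.
From mathcomp Require Import all_boot all_order all_algebra.

Set Implicit Arguments.
Unset Strict Implicit.
Unset Printing Implicit Defensive.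

Import GRing.Theory.

(** * Connected sets and avoiding labellings *)

Section Conn.
Variable G : sgraph.
Implicit Types (U W S X : {set G}).

(** Connectedness is phrased by cuts: a [W] respecting the edges of [U] cannot split [U].
    Quantifying over sets keeps it boolean and later becomes a bounded search over bit codes. *)
Definition cut_inv U W :=
  [forall x in U, forall y in U, adj x y ==> ((x \in W) == (y \in W))].

Definition conn U :=
  [forall W : {set G}, cut_inv U W ==>
     [forall x in U, forall y in U, (x \in W) == (y \in W)]].

Lemma cut_invP U W :
  reflect {in U &, forall x y, adj x y -> (x \in W) = (y \in W)} (cut_inv U W).
Proof.
apply: (iffP 'forall_in_'forall_in_implyP) => H x y.
  by move=> xU yU xy; apply/eqP/H.
by move=> xU yU xy; apply/eqP/H.
Qed.

Lemma connP U :
  reflect (forall W, {in U &, forall x y, adj x y -> (x \in W) = (y \in W)} ->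
             {in U &, forall x y, (x \in W) = (y \in W)}) (conn U).
Proof.
apply: (iffP forallP) => H W.
  move/cut_invP=> inv x y xU yU; apply/eqP.
  by move/implyP/(_ inv)/forall_inP/(_ x xU)/forall_inP: (H W); apply.
apply/implyP=> /cut_invP inv; apply/forall_inP=> x xU; apply/forall_inP=> y yU.
by apply/eqP/H.
Qed.

Lemma connected_setP U : connected_set U <-> conn U.
Proof.
split=> [cU | /connP cU x y].
  apply/connP=> W inv x y xU yU.
  have := cU (exist _ x xU) (exist _ y yU).
  move/(@closed_connect _ (@adj (induced U)) [pred z | val z \in W]); apply.
  by move=> a b; rewrite /= /induced_adj /= => ab;
    rewrite !inE (inv _ _ (valP a) (valP b) ab).
(* The cut to test consists of the vertices reachable from [x] inside [induced U]. *)
pose W := [set val z | z : {x : G | x \in U} & connect (@adj (induced U)) x z].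
have memW z : (val z \in W) = connect (@adj (induced U)) x z.
  by rewrite mem_imset ?inE //; apply: val_inj.
rewrite -memW -(cU W _ (val x) (val y) (valP x) (valP y)) ?memW ?connect0 //.
move=> a b aU bU ab.
have -> : a = val (exist (fun z => z \in U) a aU) by [].
have -> : b = val (exist (fun z => z \in U) b bU) by [].
rewrite !memW; apply/idP/idP=> /connect_trans; apply; apply: connect1 => //=.
by rewrite /induced_adj /= adj_sym.
Qed.

Lemma conn_seq (x : G) q : path (@adj G) x q -> conn [set z in x :: q].
Proof.
move=> pq; apply/connP=> W inv.
suff H y : y \in x :: q -> (y \in W) = (x \in W).
  by move=> a b; rewrite !inE => aq bq; rewrite !H.
have {}inv a b : a \in x :: q -> b \in x :: q -> adj a b -> (a \in W) = (b \in W).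
  by move=> aq bq; apply: inv; rewrite inE.
elim: q x pq inv => [|z q IH] x /=; first by rewrite inE => _ _ /eqP->.
case/andP=> xz pq inv; rewrite inE => /predU1P[-> //|yq].
rewrite (IH z) // => [|a b aq bq ab].
  by apply/esym/inv => //; rewrite !inE eqxx ?orbT.
by apply: inv => //; rewrite inE ?aq ?bq orbT.
Qed.
End Conn.

Section Avoid.
Variables (A : finZmodType) (G : sgraph).
Implicit Types (D S : {set G}) (l : {ffun G -> A}).
Local Open Scope ring_scope.

(** Labellings live on all of [G] and only subsets of [D] are tested, so one labelling can be
    restricted to several induced subgraphs without subtypes. *)
Definition zavoid l D :=
  [forall S : {set G}, [&& S \subset D, S != set0 & conn S] ==>
     (\sum_(x in S) l x != 0)].

Lemma zavoidP l D :
  reflect (forall S, S \subset D -> S != set0 -> conn S ->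
             \sum_(x in S) l x <> 0) (zavoid l D).
Proof.
apply: (iffP forallP) => H S.
  move=> SD S0 cS; apply/eqP; move/implyP: (H S); apply.
  by rewrite SD S0.
by apply/implyP=> /and3P[SD S0 cS]; apply/eqP/H.
Qed.

Lemma zavoid_sub l D D' : D \subset D' -> zavoid l D' -> zavoid l D.
Proof.
move=> DD /zavoidP H; apply/zavoidP=> S SD; apply: H.
exact: subset_trans DD.
Qed.

Lemma eq_zavoid l l' D : {in D, l =1 l'} -> zavoid l D -> zavoid l' D.
Proof.
move=> ll /zavoidP H; apply/zavoidP=> S SD S0 cS E; apply: (H S SD S0 cS).
apply: etrans E; apply: eq_bigr => x xS; apply: ll; exact: (subsetP SD).
Qed.

Lemma zero_avoidingP l : zero_avoiding l <-> zavoid l setT.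
Proof.
split=> [H | /zavoidP H S S0 /connected_setP].
  by apply/zavoidP=> S _ S0 /connected_setP; apply: H.
by apply: H; rewrite ?subsetT.
Qed.

Lemma zero_forcingP : zero_forcing A G <-> forall l, ~~ zavoid l setT.
Proof.
split=> [H l | H [l /= Hl]].
  by apply/negP=> /zero_avoidingP Hl; apply: H; exists l.
apply/negP: (H (finfun l)); rewrite negbK; apply/zero_avoidingP.
move=> S S0 cS E; apply: (Hl S S0 cS); apply: etrans E.
by apply: eq_bigr => x _; rewrite ffunE.
Qed.
End Avoid.

(** * Transport along induced embeddings *)

Section Embedding.
Variables (A : finZmodType) (G H : sgraph) (f : G -> H).
Hypotheses (f_inj : injective f) (f_adj : forall x y, adj (f x) (f y) = adj x y).
Local Open Scope ring_scope.

Lemma conn_imset (S : {set G}) : conn (f @: S) = conn S.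
Proof.
apply/connP/connP=> cS W inv x y.
  move=> xS yS; rewrite -!(mem_imset _ _ f_inj); apply: cS; try exact: imset_f.
  move=> _ _ /imsetP[a aS ->] /imsetP[b bS ->]; rewrite f_adj => ab.
  by rewrite !(mem_imset _ _ f_inj); apply: inv.
case/imsetP=> a aS -> /imsetP[b bS ->].
have := cS (f @^-1: W) _ a b aS bS; rewrite !inE; apply.
by move=> u v uS vS uv; rewrite !inE; apply: inv; rewrite ?imset_f ?f_adj.
Qed.

(** Connected subsets of the image are exactly the images of connected subsets. This serves both
    inclusions of induced subgraphs and isomorphisms. *)
Lemma zavoid_imset (l : {ffun H -> A}) (D : {set G}) :
  zavoid l (f @: D) = zavoid [ffun x => l (f x)] D.
Proof.
have sumE (S : {set G}) : \sum_(y in f @: S) l y = \sum_(x in S) [ffun x => l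
  (f x)] x.
  rewrite big_imset /=; last by move=> ? ? _ _; apply: f_inj.
  by apply: eq_bigr => x _; rewrite ffunE.
apply/zavoidP/zavoidP=> avl S SD S0 cS.
  by rewrite -sumE; apply: avl; rewrite ?imsetS ?imset_eq0 ?conn_imset.
have SE : S = f @: (f @^-1: S).
  apply/setP=> y; apply/idP/imsetP=> [yS|[x xS ->]]; last by rewrite inE in xS.
  by have /imsetP[x _ yE] := subsetP SD y yS; exists x; rewrite ?inE -?yE.
move: SD S0 cS; rewrite SE sumE conn_imset imset_eq0 => SD S0 cS; apply: avl => //.
by apply/subsetP=> x xS; rewrite -(mem_imset _ _ f_inj) (subsetP SD) ?imset_f.
Qed.
End Embedding.

Lemma zero_forcing_induced (A : finZmodType) (G : sgraph) (D : {set G}) :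
  zero_forcing A (induced D) <-> forall l : {ffun G -> A}, ~~ zavoid l D.
Proof.
pose f (x : induced D) : G := val x.
have fT : f @: setT = D.
  apply/setP=> x; apply/imsetP/idP=> [[y _ ->]|xD]; first exact: valP.
  by exists (exist _ x xD).
have avE (l : {ffun G -> A}) :
    zavoid l D = zavoid [ffun x => l (f x)] setT.
  by rewrite -{1}fT; apply: zavoid_imset => //; apply: val_inj.
apply: (iff_trans (zero_forcingP _ _)); split=> H l; first by rewrite avE.
(* A labelling of the induced graph is extended by zero outside [D], where [zavoid] does not
   look. *)
pose l' : {ffun G -> A} := [ffun x => if insub x is Some y then l y else 0%R].
have -> : l = [ffun x => l' (f x)].
  by apply/ffunP=> x; rewrite !ffunE valK.
by rewrite -avE.
Qed.

Lemma induced_minimalP (A : finZmodType) (G : sgraph) :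
  induced_minimal A G <->
  (forall l : {ffun G -> A}, ~~ zavoid l setT) /\
  (forall D : {set G}, D != setT -> exists l : {ffun G -> A}, zavoid l D).
Proof.
split=> -[/zero_forcingP zf H]; split=> // D.
  move=> DT; case: (pickP (fun l : {ffun G -> A} => zavoid l D)) => [l|no].
    by exists l.
  case: (H D); first by rewrite properEneq DT subsetT.
  by apply/zero_forcing_induced=> l; rewrite no.
rewrite properEneq => /andP[DT _] /zero_forcing_induced zfD.
by have [l] := H D DT; apply/negP.
Qed.

(** * Pigeonhole principles and zero-sum subfamilies *)

Section Pigeonhole.

Lemma card_fiber_gt (aT rT : finType) (f : aT -> rT) (D : {set aT}) (E : {set
  rT}) r q :
  {in D, forall x, f x \in E} -> #|E| <= r -> r * q < #|D| ->
  exists e, q < #|[set x in D | f x == e]|.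
Proof.
move=> fE Er big; case: (pickP (fun e => q < #|[set x in D | f x == e]|)) => [e|no].
  by exists e.
move: big; rewrite ltnNge => /negP[].
apply: (@leq_trans (#|E| * q)); last by rewrite leq_mul2r Er orbT.
rewrite -sum1_card (partition_big f (mem E)) //= -sum_nat_const.
by apply: leq_sum => e _; rewrite sum1dep_card leqNgt no.
Qed.

Variables (A : finZmodType) (I : eqType) (T : finType).
Variables (t : I -> {set T}) (s : I -> A) (P : {set T}).
Local Open Scope ring_scope.

(* Two of the partial (union, sum) pairs coincide. *)
Lemma zero_block (e : seq I) :
  {in e, forall i, t i \subset P} -> (2 ^ #|P| * #|A| <= size e)%N ->
  exists j k, [/\ (j < k <= size e)%N,
    \sum_(i <- drop j (take k e)) s i = 0 &
    \bigcup_(i <- drop j (take k e)) t i \subset \bigcup_(i <- take j e) t i].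
Proof.
move=> tP big.
pose p (j : 'I_(size e).+1) := (\bigcup_(i <- take j e) t i, \sum_(i <- take j
  e) s i).
pose E := setX (powerset P) [set: A].
have cE : #|E| = (2 ^ #|P| * #|A|)%N by rewrite cardsX card_powerset cardsT.
have pE j : p j \in E.
  rewrite !inE andbT /= big_seq.
  elim/big_rec: _ => [|i B /mem_take ie BP]; first exact: sub0set.
  by rewrite subUset tP.
(* There are [(size e).+1] prefixes and at most [size e] possible pairs. *)
have /injectivePn[j [k jk pjk]] : ~~ injectiveb p.
  apply/negP=> /injectiveP pinj; have : (#|p @: setT| <= #|E|)%N.
    by apply: subset_leq_card; apply/subsetP=> _ /imsetP[j _ ->].
  by rewrite card_imset // cardsT card_ord cE leqNgt ltnS big.
wlog {jk} jk : j k pjk / (j < k)%N.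
  move=> H; move: jk; rewrite -val_eqE neq_ltn => /orP[]; first exact: H.
  by apply: H.
have tk : take k e = take j e ++ drop j (take k e).
  by rewrite -{1}(cat_take_drop j (take k e)) take_takel // ltnW.
exists j, k; rewrite jk -ltnS ltn_ord; case: pjk => ut st; split=> //.
  move: st => /eqP; rewrite [in X in _ == X]tk big_cat /= eq_sym.
  by rewrite -subr_eq0 addrAC subrr add0r => /eqP.
by rewrite ut [X in _ \subset \bigcup_(i <- X) _]tk big_cat subsetUr.
Qed.
End Pigeonhole.

(** A zero block of the enumeration of [F] serves as [D]. The enumeration has no repetition, so the
    first [j] members, which already cover the union over [D], lie outside [D]. *)
Lemma zero_subfamily (A : finZmodType) (I T : finType) (t : I -> {set T})
    (s : I -> A) (P : {set T}) (F : {set I}) :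
  {in F, forall i, t i \subset P} -> 2 ^ #|P| * #|A| <= #|F| ->
  exists D : {set I}, [/\ D \subset F, D != set0, (\sum_(i in D) s i)%R = 0%R &
    \bigcup_(i in D) t i \subset \bigcup_(i in F :\: D) t i].
Proof.
move=> tP; rewrite [#|F|]cardE => big.
have [i /[!mem_enum]|j [k [/andP[jk ke] s0 ut]]] := @zero_block A I T t s P _ _ big.
  exact: tP.
set d := drop j (take k (enum F)) in s0 ut.
have ud : uniq d by rewrite drop_uniq // take_uniq // enum_uniq.
exists [set i in d]; split.
- by apply/subsetP=> i; rewrite inE => /mem_drop/mem_take; rewrite mem_enum.
- rewrite -card_gt0 cardsE (card_uniqP ud) size_drop size_take_min.
  by rewrite (minn_idPl ke) subn_gt0.
- by rewrite -[RHS]s0 big_uniq //=; apply: eq_bigl => i; rewrite inE.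
rewrite (eq_bigl (mem d)) => [|i]; last by rewrite inE.
rewrite -big_uniq //=; apply: subset_trans ut _.
rewrite big_uniq ?take_uniq ?enum_uniq //=; apply/bigcupsP=> i ij.
apply: bigcup_sup; rewrite !inE; have := mem_take ij; rewrite mem_enum => ->.
have := enum_uniq F; rewrite -(cat_take_drop k (enum F)) cat_uniq => /and3P[].
rewrite -(cat_take_drop j (take k _)) cat_uniq => /and3P[_ /hasPn H _] _ _.
rewrite andbT; apply/negP=> /H; rewrite /= take_takel ?ij //; exact: ltnW.
Qed.

(** * Components and their attachments *)

Section Components.
Variable G : sgraph.
Implicit Types (U W S X Y C : {set G}).

Definition adj_in S : rel G := [rel x y | [&& adj x y, x \in S & y \in S]].

Lemma adj_in_sym S : symmetric (adj_in S).
Proof. by move=> x y; rewrite /adj_in /= adj_sym [X in _ && X]andbC. Qed.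

Lemma connect_adj_in_sym S : connect_sym (adj_in S).
Proof. exact: sym_connect_sym (adj_in_sym S). Qed.

Lemma connect_invariant S (P : pred G) x y :
  (forall a b, adj_in S a b -> P a -> P b) -> connect (adj_in S) x y -> P x = P y.
Proof.
move=> cl; apply: (@closed_connect _ _ P) => a b ab.
by apply/idP/idP; apply: cl; rewrite // adj_in_sym.
Qed.

Lemma connect_mem S x y : connect (adj_in S) x y -> (x \in S) = (y \in S).
Proof. by apply: connect_invariant => a b /and3P[]. Qed.

(** For [s] in [S], this is the neighbourhood in [X] of the component of [S] containing [s]. *)
Definition attachment X S s := [set x in X | [exists z, connect (adj_in S) s z
  && adj z x]].

Definition attachments X S := [set attachment X S s | s in S].

Lemma mem_attachment X S s x : x \in X -> adj s x -> x \in attachment X S s.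
Proof. by move=> xX sx; rewrite inE xX; apply/existsP; exists s;
  rewrite connect0. Qed.

Lemma eq_attachment X S s s' : connect (adj_in S) s s' -> attachment X S s =
  attachment X S s'.
Proof.
move=> ss; apply/setP=> x; rewrite !inE; congr (_ && _).
by apply: eq_existsb => z; rewrite (same_connect (connect_adj_in_sym S) ss).
Qed.

Lemma attachments_sub X S : attachments X S \subset powerset X.
Proof.
by apply/subsetP=> _ /imsetP[s _ ->]; rewrite inE; apply/subsetP=> x /setIdP[].
Qed.

(* If [Y :|: S] is connected and [Y] is non-empty, every component of [S] has
   a neighbour in [Y]; so whether it is connected can be read off [attachments
     X S]. *)
Lemma attachments_conn X Y S S' : Y \subset X -> Y != set0 ->
  S \subset ~: X -> S' \subset ~: X -> attachments X S = attachments X S' ->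
  conn (Y :|: S) -> conn (Y :|: S').
Proof.
move=> YX /set0Pn[y0 y0Y] SX S'X tE /connP cS; apply/connP=> W inv.
have SnX s : s \in S -> s \notin X by move/(subsetP SX); rewrite inE.
have S'nX s : s \in S' -> s \notin X by move/(subsetP S'X); rewrite inE.
have YnS y : y \in Y -> y \notin S.
  by move/(subsetP YX) => yX; apply: contraL yX => /SnX.
have YinX y : y \in Y -> y \in X by move/(subsetP YX).
(* [W] is constant along a component of [S'] and across its edges to [Y]. *)
have nbW s y : s \in S' -> y \in Y -> y \in attachment X S' s -> (y \in W) = (s
  \in W).
  move=> sS' yY /setIdP[_ /existsP[z /andP[sz zy]]].
  have zS' : z \in S' by rewrite -(connect_mem sz).
  rewrite -(inv z y) ?inE ?yY ?zS' ?orbT //; apply/esym.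
  apply: (connect_invariant (P := mem W) _ sz) => a b /and3P[ab aS bS] /=.
  by rewrite (inv a b) ?inE ?aS ?bS ?orbT.
have nbY s : s \in S -> exists2 y, y \in Y & y \in attachment X S s.
  move=> sS; apply/exists_inP; apply: contraT => /exists_inPn no.
  (* Without a neighbour in [Y], the component of [s] in [S] would be a cut separating [s] from
     [y0]. *)
  have := cS [set z | connect (adj_in S) s z] _ y0 s.
  rewrite !inE y0Y sS orbT connect0 => H.
  have := YnS _ y0Y; rewrite -(connect_mem (_ : connect _ s y0)) ?sS //.
  apply: H => // a b.
  have half u v : u \in Y :|: S -> v \in Y :|: S -> adj u v ->
      connect (adj_in S) s u -> connect (adj_in S) s v.
    move=> uU vU uv su; have uS : u \in S by rewrite -(connect_mem su).
    case/setUP: vU => [vY|vS].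
      case/negP: (no _ vY); rewrite (eq_attachment X su); apply: mem_attachment => //.
      exact: YinX.
    by apply: connect_trans su (connect1 _); rewrite /adj_in /= uv uS.
  move=> aU bU ab; rewrite !inE; apply/idP/idP; first exact: half.
  by apply: half; rewrite // adj_sym.
(* [W'] carries the cut [W] over to [Y :|: S]: it agrees with [W] on [Y], and a component of [S]
   joins it when it has a neighbour in [Y] lying in [W]. *)
pose W' := (X :&: W) :|: [set s in S | [exists y in Y, (y \in attachment X S s)
  && (y \in W)]].
have W'Y y : y \in Y -> (y \in W') = (y \in W).
  by move=> yY; rewrite !inE (YinX _ yY) (negPf (YnS _ yY)) orbF.
have nbW' s y : s \in S -> y \in Y -> y \in attachment X S s -> (y \in W) = (s
  \in W').
  move=> sS yY ysS; rewrite !inE sS (negPf (SnX _ sS)) /=.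
  apply/idP/exists_inP=> [yW | [y' y'Y /andP[y's y'W]]].
    by exists y; rewrite ?ysS.
  (* A component of [S'] with the same attachment forces all these neighbours to one side of [W]. *)
  have /imsetP[s' s'S' sE] : attachment X S s \in attachments X S' by rewrite
    -tE imset_f.
  by rewrite (nbW s') -?sE // -(nbW s' y') -?sE.
have invW' : {in Y :|: S &, forall x y, adj x y -> (x \in W') = (y \in W')}.
  have YS y s : y \in Y -> s \in S -> adj s y -> (y \in W') = (s \in W').
    move=> yY sS sy; rewrite W'Y // (nbW' s) //; apply: mem_attachment => //;
      exact: YinX.
  move=> x y /setUP[xU|xU] /setUP[yU|yU] xy.
  - by rewrite !W'Y //; apply: inv; rewrite // inE ?xU ?yU.
  - by apply: YS; rewrite // adj_sym.
  - by apply/esym/YS.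
  - have xyS : connect (adj_in S) x y by apply: connect1; rewrite /adj_in /= xy xU.
    have [z zY zx] := nbY _ xU.
    by rewrite -(nbW' x z) // -(nbW' y z) // -(eq_attachment X xyS).
have allW x : x \in Y :|: S' -> (x \in W) = (y0 \in W).
  have YW y : y \in Y -> (y \in W) = (y0 \in W).
    by move=> yY; rewrite -!W'Y //; apply: cS; rewrite // inE ?yY ?y0Y.
  case/setUP=> [|xS']; first exact: YW.
  have /imsetP[s sS xE] : attachment X S' x \in attachments X S by rewrite tE imset_f.
  have [y yY ys] := nbY _ sS.
  by rewrite -(nbW x y) ?YW // xE.
by move=> x y xU yU; rewrite !allW.
Qed.

Definition component X x := [set y | connect (adj_in (~: X)) x y].
Definition components X := [set component X x | x in ~: X].

Lemma mem_component X x : x \in component X x. Proof. by rewrite inE. Qed.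

Lemma component_components X x : x \notin X -> component X x \in components X.
Proof. by move=> xX; apply: imset_f; rewrite inE. Qed.

Lemma components_sub X C : C \in components X -> C \subset ~: X.
Proof.
case/imsetP=> x xX ->; apply/subsetP=> y; rewrite inE => xy.
by rewrite -(connect_mem xy).
Qed.

Lemma components_eq X C x : C \in components X -> x \in C -> C = component X x.
Proof.
case/imsetP=> y yX ->; rewrite inE => yx; apply/setP=> z; rewrite !inE.
by rewrite (same_connect (connect_adj_in_sym _) yx).
Qed.

Lemma components_adj X C x y :
  C \in components X -> x \in C -> y \notin X -> adj x y -> y \in C.
Proof.
move=> CX xC yX xy; rewrite (components_eq CX xC) inE; apply: connect1.
by rewrite /adj_in /= xy (subsetP (components_sub CX)) // inE.
Qed.

Lemma components_disjoint X C C' x : C \in components X -> C' \in components X ->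
  x \in C -> x \in C' -> C = C'.
Proof. by move=> CX C'X xC xC';
  rewrite (components_eq CX xC) (components_eq C'X xC'). Qed.

(** A walk inside [S] avoids [X], so it never leaves the component [C] where it starts. Attachments
    can thus be computed one component at a time. *)
Lemma attachment_component X S C s : S \subset ~: X -> C \in components X -> s
  \in C -> s \in S ->
  attachment X S s = attachment X (S :&: C) s.
Proof.
move=> SX CX sC sS; apply/setP=> x; rewrite !inE; congr (_ && _).
apply: eq_existsb => z; congr (_ && _); apply/idP/idP=> sz.
  rewrite -(connect_invariant (P := connect (adj_in (S :&: C)) s) _ sz) ?connect0 //.
  move=> a b /and3P[ab aS bS] sa.
  have /setIP[_ aC] : a \in S :&: C by rewrite -(connect_mem sa) inE sS.
  apply: (connect_trans sa); apply: connect1.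
  rewrite /adj_in /= ab !inE aS bS aC.
  by apply: (components_adj CX aC _ ab); have := subsetP SX b bS; rewrite inE.
apply: connect_sub sz => a b /= /and3P[ab /setIP[aS _] /setIP[bS _]].
by apply: connect1; rewrite /adj_in /= ab aS.
Qed.

Lemma attachmentsP X S N : S \subset ~: X ->
  reflect (exists2 C, C \in components X & N \in attachments X (S :&: C)) (N
    \in attachments X S).
Proof.
move=> SX; apply: (iffP imsetP) => [[s sS ->]|[C CX /imsetP[s /setIP[sS sC] ->]]].
  have sX := subsetP SX s sS; rewrite inE in sX.
  exists (component X s); first exact: component_components.
  rewrite (attachment_component SX (component_components sX) (mem_component X s) sS).
  by apply: imset_f; rewrite !inE sS connect0.
by exists s; rewrite // (attachment_component SX CX).
Qed.

Lemma conn_sub_component X U x : conn U -> [disjoint U & X] -> x \in U -> U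
  \subset component X x.
Proof.
move=> /connP cU UX xU; apply/subsetP=> y yU.
have nX z : z \in U -> z \notin X by move/(disjointFr UX)->.
rewrite -(cU _ _ x y) ?mem_component // => a b aU bU ab.
apply/idP/idP=> H; [have ab' := ab | have ab' : adj b a by rewrite adj_sym];
  by apply: (components_adj (component_components (nX _ xU)) H _ ab'); apply: nX.
Qed.

Lemma sum_components (V : zmodType) X U (D : {set {set G}}) (F : G -> V) : D
  \subset components X ->
  (\sum_(x in U :&: \bigcup_(C in D) C) F x = \sum_(C in D) \sum_(x in U :&: C)
    F x)%R.
Proof.
move=> DX; rewrite (partition_big (component X) (mem D)) /= => [|x].
  apply: eq_bigr => C CD; apply: eq_bigl => x; rewrite !inE.
  case: (x \in U) => //=; apply/andP/idP=> [[/bigcupP[C' C'D xC'] /eqP<-]|xC].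
    exact: mem_component.
  rewrite -(components_eq (subsetP DX C CD) xC) eqxx; split=> //.
  by apply/bigcupP; exists C.
by case/setIP=> _ /bigcupP[C CD xC]; rewrite -(components_eq (subsetP DX C CD) xC).
Qed.
End Components.

(** For [k] vertices in [X] and a group of order [n], [q] counts the pairs (family of subsets of
    [X], group element), [2 ^ q] the sets of pairs and [2 ^ 2 ^ q] the families of such sets. The
    last factor [q] is the size required by [zero_subfamily]; the successor accounts for the deleted
    component. *)
Definition components_bound k n :=
  let q := 2 ^ 2 ^ k * n in 2 ^ 2 ^ q * (2 ^ q * q).+1.

Lemma components_bound_homo n : {homo components_bound^~ n : k k' / k <= k'}.
Proof.
move=> k k' kk; rewrite /components_bound.
have qq : 2 ^ 2 ^ k * n <= 2 ^ 2 ^ k' * n.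
  by rewrite leq_mul2r !leq_exp2l // kk orbT.
by apply: leq_mul; rewrite ?ltnS; [|apply: leq_mul => //]; rewrite !leq_exp2l.
Qed.

(** * The bound *)

Section Bound.
Variables (A : finZmodType) (G : sgraph).
Hypothesis forcing : forall l : {ffun G -> A}, ~~ zavoid l setT.
Hypothesis minimal :
  forall D : {set G}, D != setT -> exists l : {ffun G -> A}, zavoid l D.
Implicit Types (U S X C D : {set G}) (l : {ffun G -> A}).
Local Open Scope ring_scope.

(** These pairs are all that a component [C] labelled by [l] can contribute to a connected set
    meeting [X]. *)
Definition behaviour X C l : {set {set {set G}} * A} :=
  [set (attachments X S, \sum_(x in S) l x) | S in powerset C].

Definition behaviours X C : {set {set {set {set G}} * A}} :=
  [set behaviour X C l | l in [pred l | zavoid l C]].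

Lemma behaviour_sub X C l :
  behaviour X C l \subset setX (powerset (powerset X)) setT.
Proof. by apply/subsetP=> _ /imsetP[S _ ->]; rewrite !inE attachments_sub. Qed.

(* Many components offer the same behaviours; deleting one of them, [C0],
   leaves an avoiding labelling [l], under which many of the others behave
   alike.  Copying their behaviour to [C0] yields an avoiding labelling of [G]. *)
Lemma card_components X : (#|components X| <= components_bound #|X| #|A|)%N.
Proof.
rewrite leqNgt; apply/negP; rewrite /components_bound /=.
set q := (2 ^ 2 ^ #|X| * #|A|)%N => big.
pose E := setX (powerset (powerset X)) [set: A].
have cE : #|E| = q by rewrite cardsX !card_powerset cardsT.
(* First pigeonhole: many components with the same possible behaviours. *)
have [||R] := @card_fiber_gt _ _ (behaviours X) (components X) (powerset
  (powerset E)) _ _ _ _ big.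
- move=> C _; rewrite inE; apply/subsetP=> _ /imsetP[l _ ->].
  by rewrite inE behaviour_sub.
- by rewrite !card_powerset cE.
set F := [set C in _ | _] => bigF.
have /set0Pn[C0 C0F] : F != set0 by rewrite -card_gt0 (leq_trans _ bigF).
have [C0X /eqP C0R] : C0 \in components X /\ behaviours X C0 == R by move: C0F;
  rewrite inE => /andP.
have [|l /zavoidP avl] := minimal (D := ~: C0).
  apply/eqP=> /(congr1 (fun D => ~: D)); rewrite setCK setCT => C00.
  case/imsetP: C0X => x _ C0x; have := mem_component X x.
  by rewrite -C0x C00 inE.
(* Second pigeonhole: among them, more than [q] components behave identically under the fixed
   [l]. *)
have [|||B] := @card_fiber_gt _ _ (fun C => behaviour X C l) (F :\ C0)
  (powerset E) (2 ^ q) q.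
- by move=> C _; rewrite inE behaviour_sub.
- by rewrite card_powerset cE.
- by move: bigF; rewrite (cardsD1 C0 F) C0F add1n ltnS.
set F' := [set C in _ | _] => bigF'.
have F'P C : C \in F' -> [/\ C != C0, C \in components X, behaviours X C = R &
  behaviour X C l = B].
  by rewrite !inE -!andbA => /and4P[-> -> /eqP-> /eqP->].
have sub0C C : C \in components X -> C != C0 -> C \subset ~: C0.
  move=> CX CC0; apply/subsetP=> x xC; rewrite inE; apply: contra_neqN CC0 => xC0.
  exact: (components_disjoint CX C0X xC xC0).
(* [B] is a possible behaviour of a member of [F'], hence also of [C0]. *)
have [l0 /zavoidP avl0 BE] : exists2 l0, zavoid l0 C0 & behaviour X C0 l0 = B.
  have /set0Pn[C CF'] : F' != set0 by rewrite -card_gt0 (leq_ltn_trans _ bigF').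
  have [CC0 CX CR CB] := F'P C CF'.
  have : B \in behaviours X C0.
    rewrite C0R -CR -CB; apply: imset_f; rewrite inE.
    by apply: (zavoid_sub (sub0C C CX CC0)); apply/zavoidP.
  by case/imsetP=> l0; rewrite inE => ? ->; exists l0.
pose l' : {ffun G -> A} := [ffun x => if x \in C0 then l0 x else l x].
have l'0 S : S \subset C0 -> \sum_(x in S) l' x = \sum_(x in S) l0 x.
  by move=> SC0; apply: eq_bigr => x /(subsetP SC0) xC0; rewrite ffunE xC0.
have l'1 S : S \subset ~: C0 -> \sum_(x in S) l' x = \sum_(x in S) l x.
  move=> SC0; apply: eq_bigr => x /(subsetP SC0); rewrite inE ffunE.
  by move/negPf->.
case/negP: (forcing l'); apply/zavoidP=> U _ U0 cU sU0.
(* A connected set missing [X] lies in one component, where [l'] is either [l0] or [l], both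
   avoiding. *)
have [UX|UX] := boolP [disjoint U & X].
  case/set0Pn: (U0) => x xU; have UC := conn_sub_component cU UX xU.
  have [CC0|CC0] := eqVneq (component X x) C0.
    rewrite CC0 in UC; apply: (avl0 U) => //; by rewrite -l'0.
  have {}UC : U \subset ~: C0.
    by apply: subset_trans UC _; apply: sub0C;
      rewrite ?component_components ?(disjointFr UX).
  by apply: (avl U) => //; rewrite -l'1.
have F'X : F' \subset components X by apply/subsetP=> C /F'P[].
(* The traces of [U] on the members of [D] sum to zero and their attachments survive in [F' :\: D].
   Removing them empties some [C1], which makes room for a copy of the trace of [U] on [C0]. *)
have [||D [DF' /set0Pn[C1 C1D] sD tD]] := @zero_subfamily A _ _
    (fun C => attachments X (U :&: C)) (fun C => \sum_(x in U :&: C) l' x)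
      (powerset X) F'.
- by move=> C _; apply: attachments_sub.
- by rewrite card_powerset ltnW.
have DX := subset_trans DF' F'X.
have [C10 C1X C1R C1B] := F'P C1 (subsetP DF' _ C1D).
(* [C1] behaves under [l] as [C0] does under [l0], so some [S1] imitates [U :&: C0]. *)
have [S1 S1C1 [tS1 sS1]] : exists2 S1 : {set G}, S1 \subset C1 &
    attachments X S1 = attachments X (U :&: C0) /\ \sum_(x in S1) l x = \sum_(x
      in U :&: C0) l' x.
  have : (attachments X (U :&: C0), \sum_(x in U :&: C0) l' x) \in behaviour X C1 l.
    rewrite C1B -BE l'0 ?subsetIr //; apply/imsetP; exists (U :&: C0) => //.
    by rewrite inE subsetIr.
  by case/imsetP=> S1; rewrite inE => ? [-> ->]; exists S1.
pose UD := \bigcup_(C in D) C.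
pose V := (U :\: UD) :\: C0.
have nD x : x \in C0 -> x \notin UD.
  move=> xC0; apply/bigcupP=> -[C CD xC].
  have [/eqP[]] := F'P C (subsetP DF' _ CD).
  exact: components_disjoint (subsetP DX _ CD) C0X xC xC0.
have VS1 : [disjoint V & S1].
  rewrite -setI_eq0; apply/eqP/setP=> x; rewrite !inE.
  apply/negP=> /andP[/and3P[_ /bigcupP no _] xS1]; apply: no; exists C1 => //.
  exact: (subsetP S1C1).
have V0 : V \subset ~: C0 by apply/subsetP=> x; rewrite !inE => /and3P[].
have S10 : S1 \subset ~: C0 := subset_trans S1C1 (sub0C C1 C1X C10).
(* [V :|: S1] misses [C0], is connected and has zero sum under [l], against the choice of [l]. *)
apply: (avl (V :|: S1)).
- by rewrite subUset V0.
- case/pred0Pn: UX => x /= /andP[xU xX]; apply/set0Pn; exists x.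
  have nX C : C \in components X -> x \notin C.
    by move=> CX; apply: contraL xX => /(subsetP (components_sub CX)); rewrite inE.
  rewrite !inE xU nX //= andbT; apply/orP; left; apply/bigcupP=> -[C CD].
  by apply/negP/nX/(subsetP DX).
- have UE : U = (U :&: X) :|: (U :\: X) by rewrite setID.
  have VE : V :|: S1 = (U :&: X) :|: ((V :|: S1) :\: X).
    rewrite -{1}(setID (V :|: S1) X); congr (_ :|: _); apply/setP=> x; rewrite !inE.
    case: (boolP (x \in X)) => [xX|]; rewrite ?andbF // !andbT.
    have nX C : C \in components X -> x \notin C.
      by move=> CX; apply: contraL xX => /(subsetP (components_sub CX)); rewrite inE.
    rewrite (nX C0) //= (negPf (contra (subsetP S1C1 x) (nX C1 C1X))) orbF.
    suff -> : x \notin UD by [].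
    by apply/bigcupP=> -[C CD]; apply/negP/nX/(subsetP DX).
  (* Both sets have the same trace on [X], so it is enough to match their attachments. *)
  rewrite VE; move: cU; rewrite {1}UE.
  apply: (@attachments_conn _ X); rewrite ?subsetIr ?subsetDr //.
    by move: UX; rewrite -setI_eq0.
  have memX C x : C \in components X -> x \in C -> x \notin X.
    by move=> CX /(subsetP (components_sub CX)); rewrite inE.
  have cX C : C \in components X -> (U :\: X) :&: C = U :&: C.
    move=> CX; apply/setP=> x; rewrite !inE; case: (boolP (x \in C));
      rewrite ?andbF // !andbT.
    by move/(memX _ _ CX)->.
  have cV C : C \in components X -> C \notin D -> C != C0 ->
      ((V :|: S1) :\: X) :&: C = U :&: C.
    move=> CX CD CC0; apply/setP=> x; rewrite !inE.
    case: (boolP (x \in C)) => xC; rewrite ?andbF // !andbT (memX C) //=.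
    have -> : x \in C0 = false by apply: contra_neqF CC0 =>
      /(components_disjoint CX C0X xC).
    have -> : x \in S1 = false.
      apply: contraNF CD => /(subsetP S1C1) xC1.
      by rewrite (components_disjoint CX C1X xC xC1).
    rewrite orbF /=; case: (boolP (x \in UD)) => //= /bigcupP[C' C'D xC'].
    by rewrite (components_disjoint CX (subsetP DX _ C'D) xC xC') C'D in CD.
  have cV1 : ((V :|: S1) :\: X) :&: C1 = S1.
    apply/setP=> x; rewrite !inE; apply/idP/idP=> [/andP[/andP[_ /orP[|//]]]|xS1].
      by case/and3P=> _ /bigcupP no _ xC1; case: no; exists C1.
    by have xC1 := subsetP S1C1 x xS1; rewrite xC1 xS1 orbT (memX C1).
  apply/setP=> N.
  (* Attachments lost in [D] are found in [F' :\: D], and those of [C0] in [C1]. *)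
  apply/(attachmentsP _ (subsetDr U X))/(attachmentsP _ (subsetDr (V :|: S1) X)).
    case=> C CX; rewrite cX // => NC.
    have [CD|CD] := boolP (C \in D).
      have : N \in \bigcup_(i in D) attachments X (U :&: i) by apply/bigcupP;
        exists C.
      case/(subsetP tD)/bigcupP=> C' /setDP[C'F' C'D] NC'.
      have [C'C0 C'X _ _] := F'P C' C'F'.
      by exists C'; rewrite ?cV.
    have [CC0|CC0] := eqVneq C C0; last by exists C; rewrite ?cV.
    by exists C1; rewrite // cV1 tS1 -CC0.
  case=> C CX.
  have [->|CC1] := eqVneq C C1.
    by rewrite cV1 tS1 => NC; exists C0; rewrite ?cX.
  have [CD|CD] := boolP (C \in D).
    case/imsetP=> s /setIP[]; rewrite !inE => /andP[_ /orP[|]].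
      by case/and3P=> _ /bigcupP no _ sC; case: no; exists C.
    move=> /(subsetP S1C1) sC1 sC; case/eqP: CC1;
      exact: (components_disjoint CX C1X sC sC1).
  have [->|CC0] := eqVneq C C0.
    case/imsetP=> s /setIP[]; rewrite !inE => /andP[_ /orP[/andP[/negP]|]] //.
    by move/(subsetP S10); rewrite inE => /negP.
  by rewrite cV // => NC; exists C; rewrite ?cX.
move: sU0; rewrite (big_setID UD) /= (sum_components _ _ DX) sD add0r
  (big_setID C0) /=.
have -> : (U :\: UD) :&: C0 = U :&: C0.
  apply/setP=> x; rewrite !inE; case: (boolP (x \in C0)); rewrite ?andbF // => /nD ->.
  by [].
rewrite -sS1 (l'1 _ V0) addrC => sE; apply: etrans sE.
by rewrite -bigU //=; apply: eq_bigl => x; rewrite !inE.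
Qed.

Local Close Scope ring_scope.

(** Otherwise the first [#|A|.+1] vertices of the path form a proper subset and carry an avoiding
    labelling. [zero_block] with empty sets then gives a consecutive block of zero sum, which is
    connected. *)
Lemma path_bound (v : G) p : #|A|.+1 < #|G| -> uniq (v :: p) ->
  path (@adj G) v p -> size p < #|A|.
Proof.
move=> bigG uvp pvp; rewrite ltnNge; apply/negP=> bigp.
pose e := take #|A|.+1 (v :: p).
have se : size e = #|A|.+1 by rewrite size_takel.
have [|l] := minimal (D := [set x in e]).
  apply/eqP=> eT; have := cardsT G; rewrite -eT cardsE => eG.
  by have := card_size e; rewrite eG se leqNgt bigG.
move/zavoidP=> avl.
have [||j [k [/andP[jk ke] s0 _]]] := @zero_block A G G (fun=> set0) l set0 e.
- by move=> x _; apply: sub0set.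
- by rewrite cards0 expn0 mul1n se.
have ue : uniq e by apply: take_uniq.
set d := drop j (take k e) in s0.
have ud : uniq d by rewrite drop_uniq ?take_uniq.
have sd : sorted (@adj G) d by apply/drop_sorted/take_sorted/take_sorted.
have d0 : 0 < size d by rewrite size_drop size_takel // subn_gt0.
apply: (avl [set x in d]).
- by apply/subsetP=> x; rewrite !inE => /mem_drop/mem_take.
- by rewrite -card_gt0 cardsE (card_uniqP ud).
- by case: (d) d0 sd => // x q _ /conn_seq.
rewrite big_uniq //= in s0; apply: etrans s0.
by apply: eq_bigl => x; rewrite inE.
Qed.

Let g := components_bound #|A| #|A|.

(** Depth-first search with stack [p], next vertex [v] and remaining depth [j]. Removing [v] splits
    [C] into at most [g] components, each adjacent to [v], to which induction applies with stack
    [v :: p]. At depth 0 the path [v :: p] is too long. *)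
Lemma component_bound j (p : seq G) C v : #|A|.+1 < #|G| -> uniq p ->
  size p + j = #|A| -> C \in components [set x in p] -> v \in C ->
  path (@adj G) v p -> #|C| <= g.+1 ^ j.
Proof.
move=> bigG; elim: j p C v => [|j IH] p C v up sp CX vC pvp.
all: have vp : v \notin p by have := subsetP (components_sub CX) v vC; rewrite !inE.
  have := path_bound bigG _ pvp; rewrite /= vp up -sp addn0 ltnn => H.
  by have := H isT.
set X := [set x in p] in CX; pose X' := [set x in v :: p].
have uvp : uniq (v :: p) by rewrite /= vp.
have sp' : size (v :: p) + j = #|A| by rewrite -sp addnS.
have inX x : x \in C -> x \notin p.
  by move/(subsetP (components_sub CX)); rewrite !inE.
pose D := [set C' in components X' | C' \subset C].
have CsubD : C :\ v \subset \bigcup_(C' in D) C'.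
  apply/subsetP=> x /setD1P[xv xC]; apply/bigcupP; exists (component X' x);
    last exact: mem_component.
  rewrite inE component_components /= ?inE ?negb_or ?xv ?inX //.
  rewrite (components_eq CX xC); apply/subsetP=> y; rewrite !inE.
  apply: connect_sub => a b /and3P[ab aX' bX']; apply: connect1.
  by move: aX' bX'; rewrite /adj_in /= ab !inE !negb_or => /andP[_ ->] /andP[_ ->].
have cD C' : C' \in D -> #|C'| <= g.+1 ^ j.
  rewrite inE => /andP[C'X' C'C].
  suff [w wC' wv] : exists2 w, w \in C' & adj w v.
    by apply: (IH (v :: p) C' w); rewrite //= wv.
  (* A part [C'] without neighbour [v] would be closed in [C], which however joins it to [v]. *)
  apply/exists_inP; apply: contraT => /exists_inPn no.
  have /imsetP[x xX' C'x] := C'X'.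
  have xC' : x \in C' by rewrite C'x mem_component.
  have xC := subsetP C'C x xC'.
  have : v \in C' ; last first.
    by move/(subsetP (components_sub C'X')); rewrite !inE eqxx.
  have xv : connect (adj_in (~: X)) x v.
    by move: vC; rewrite {1}(components_eq CX xC) inE.
  rewrite -[v \in C'](connect_invariant (P := mem C') _ xv) //= => a b.
  move=> /and3P[ab aX bX] /= aC'; apply: (components_adj C'X' aC' _ ab).
  move: bX; rewrite !inE negb_or => ->; rewrite andbT.
  by apply: contraNneq (no a aC') => <-.
rewrite (cardsD1 v) vC; apply: (@leq_trans (1 + g * g.+1 ^ j)).
  rewrite leq_add2l; apply: leq_trans (subset_leq_card CsubD) _.
  apply: leq_trans (leq_card_cover D) _.
  apply: (@leq_trans (\sum_(C' in D) g.+1 ^ j)); first exact: leq_sum.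
  rewrite sum_nat_const leq_mul2r; apply/orP; right.
  apply: (@leq_trans #|components X'|).
    by apply: subset_leq_card; apply/subsetP=> C'; rewrite inE => /andP[].
  apply: leq_trans (card_components X') _; apply: components_bound_homo.
  by rewrite cardsE (card_uniqP uvp) -sp' leq_addr.
by rewrite expnSr mulnS mulnC leq_add2r expn_gt0.
Qed.

(** Graphs with at most [#|A|.+1] vertices satisfy the bound directly. Otherwise the search starts
    with an empty stack in each of the at most [g] components of [G], whence the extra factor. *)
Lemma minimal_bound : #|G| <= g.+1 ^ #|A|.+1.
Proof.
have g0 : 0 < g by rewrite muln_gt0 expn_gt0.
have [small|bigG] := leqP #|G| #|A|.+1.
  apply: leq_trans small _; apply: leq_trans (ltnW (ltn_expl _ (isT : 1 < 2))) _.
  by rewrite leq_exp2r.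
rewrite -cardsT; apply: (@leq_trans #|cover (components (set0 : {set G}))|).
  apply/subset_leq_card/subsetP=> x _; apply/bigcupP;
    exists (component set0 x); last exact: mem_component.
  by rewrite component_components ?inE.
apply: leq_trans (leq_card_cover _) _.
apply: (@leq_trans (\sum_(C in components (set0 : {set G})) g.+1 ^ #|A|)).
  apply: leq_sum => C CX; case/imsetP: (CX) => v _ Cv.
  apply: (@component_bound _ [::] C v) => //; last by rewrite Cv mem_component.
rewrite sum_nat_const expnS leq_mul2r; apply/orP; right.
apply: leqW; apply: leq_trans (card_components _) _; apply: components_bound_homo.
by rewrite cards0.
Qed.

End Bound.

Definition size_bound n := (components_bound n n).+1 ^ n.+1.

Lemma induced_minimal_bound (A : finZmodType) (G : sgraph) :
  induced_minimal A G -> #|G| <= size_bound #|A|.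
Proof. by move=> /induced_minimalP[zf mn]; apply: minimal_bound. Qed.

(** * Recursive functions of an environment *)

(* A variable is a position in the environment; positions past the end read 0. *)
Definition rc (f : seq nat -> nat) := forall n, recursive (fun v : n.-tuple nat
  => f v).

Lemma rc_ext f g : f =1 g -> rc f -> rc g.
Proof. by move=> fg rf n; apply: rec_ext (rf n) => v. Qed.

Lemma rc_var i : rc (fun e => nth 0 e i).
Proof.
move=> n; have [ltin|leni] := ltnP i n.
  by apply: rec_ext (rec_proj (Ordinal ltin)) => v; rewrite (tnth_nth 0).
by apply: rec_ext (rec_zero n) => v; rewrite nth_default ?size_tuple.
Qed.

Lemma rc_comp F (fs : seq (seq nat -> nat)) : rc F ->
  (forall i, i < size fs -> rc (nth (fun=> 0) fs i)) ->
  rc (fun e => F [seq f e | f <- fs]).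
Proof.
move=> rF rfs n.
have := @rec_comp n (size fs) _ (fun i v => nth (fun=> 0) fs i v) (rF _) (fun i
  => rfs i (ltn_ord i) n).
apply: rec_ext => v; congr F; apply: (@eq_from_nth _ 0);
  rewrite size_tuple ?size_map // => i lti.
by rewrite -[i]/(val (Ordinal lti)) -tnth_nth tnth_mktuple /= (nth_map (fun=> 0)).
Qed.

Lemma rc_drop k f : rc f -> rc (fun e => f (drop k e)).
Proof.
move=> rf n.
have := @rec_comp n (n - k) _ (fun i v => nth 0 v (k + i)) (rf _) (fun i =>
  rc_var (k + i) n).
apply: rec_ext => v; congr f; apply: (@eq_from_nth _ 0);
  first by rewrite size_tuple size_drop size_tuple.
rewrite size_tuple => i lti.
by rewrite -[i]/(val (Ordinal lti)) -tnth_nth tnth_mktuple /= nth_drop.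
Qed.

Lemma rc_prec b a g : rc b -> rc a -> rc g ->
  rc (fun e => iteri (b e) (fun k r => g [:: k, r & e]) (a e)).
Proof.
move=> rb ra rg n.
(* The recursion variable comes first in [rec_prec]; composition with [b v :: v] supplies the
   bound. *)
have := @rec_comp n n.+1 _ (fun i v => nth 0 (b v :: v) i) (rec_prec (ra n) (rg
  n.+2)).
move=> H; apply: rec_ext (H _) => [v|i]; last first.
  by case: i => -[|i] lti; [exact: (rb n) | exact: (rc_var i n)].
have -> : [tuple nth 0 (b v :: v) i | i < n.+1] = [tuple of b v :: v].
  by apply: eq_from_tnth => i; rewrite tnth_mktuple (tnth_nth 0).
have -> : behead_tuple [tuple of b v :: v] = v by apply: val_inj.
by rewrite theadE.
Qed.

(** The body is read in the environment extended by counter and accumulator; [drop 2] recovers the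
    outer one, so bodies can use named variables. *)
Lemma rc_iteri b a (g : nat -> nat -> seq nat -> nat) : rc b -> rc a ->
  rc (fun e => g (nth 0 e 0) (nth 0 e 1) (drop 2 e)) ->
  rc (fun e => iteri (b e) (fun k r => g k r e) (a e)).
Proof.
move=> rb ra rg; apply: rc_ext (rc_prec rb ra rg) => e.
by apply: eq_iteri => k r; rewrite /= drop0.
Qed.

Lemma rc_succ f : rc f -> rc (fun e => (f e).+1).
Proof.
move=> rf n; apply: rec_ext (rec_comp rec_succ (fun i : 'I_1 => rf n)) => v.
by rewrite /thead tnth_mktuple.
Qed.

Lemma rc_const c : rc (fun=> c).
Proof.
elim: c => [n|c IH]; [exact: rec_zero | exact: (rc_succ IH)].
Qed.

Section Arity.
Implicit Types f g h i j : seq nat -> nat.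

(** Arguments are read from the first positions; the [rc_app] lemmas then substitute arbitrary
    recursive terms. *)
Definition rec1 (F : nat -> nat) := rc (fun e => F (nth 0 e 0)).
Definition rec2 (F : nat -> nat -> nat) := rc (fun e => F (nth 0 e 0) (nth 0 e 1)).
Definition rec3 (F : nat -> nat -> nat -> nat) :=
  rc (fun e => F (nth 0 e 0) (nth 0 e 1) (nth 0 e 2)).
Definition rec4 (F : nat -> nat -> nat -> nat -> nat) :=
  rc (fun e => F (nth 0 e 0) (nth 0 e 1) (nth 0 e 2) (nth 0 e 3)).
Definition rec5 (F : nat -> nat -> nat -> nat -> nat -> nat) :=
  rc (fun e => F (nth 0 e 0) (nth 0 e 1) (nth 0 e 2) (nth 0 e 3) (nth 0 e 4)).

Lemma rc_app1 F f : rec1 F -> rc f -> rc (fun e => F (f e)).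
Proof. by move=> rF rf; apply: (rc_comp (fs := [:: f]) rF) => -[]. Qed.

Lemma rc_app2 F f g : rec2 F -> rc f -> rc g -> rc (fun e => F (f e) (g e)).
Proof. by move=> rF rf rg; apply: (rc_comp (fs := [:: f; g]) rF) => -[|[]]. Qed.

Lemma rc_app3 F f g h : rec3 F -> rc f -> rc g -> rc h ->
  rc (fun e => F (f e) (g e) (h e)).
Proof. by move=> rF *; apply: (rc_comp (fs := [:: f; g; h]) rF) => -[|[|[]]]. Qed.

Lemma rc_app4 F f g h i : rec4 F -> rc f -> rc g -> rc h -> rc i ->
  rc (fun e => F (f e) (g e) (h e) (i e)).
Proof. by move=> rF *; apply: (rc_comp (fs := [:: f; g; h;
  i]) rF) => -[|[|[|[]]]]. Qed.

Lemma rc_app5 F f g h i j : rec5 F -> rc f -> rc g -> rc h -> rc i -> rc j ->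
  rc (fun e => F (f e) (g e) (h e) (i e) (j e)).
Proof.
by move=> rF *; apply: (rc_comp (fs := [:: f; g; h; i; j]) rF) => -[|[|[|[|[]]]]].
Qed.
End Arity.

(* A bound variable of [iteri] shifts the environment by two positions. *)
Ltac rcvar := first
  [ exact (rc_const _) | exact (rc_var _) | exact (rc_drop _ (rc_var _))
  | exact (rc_drop _ (rc_drop _ (rc_var _)))
  | exact (rc_drop _ (rc_drop _ (rc_drop _ (rc_var _))))
  | exact (rc_drop _ (rc_drop _ (rc_drop _ (rc_drop _ (rc_var _))))) ].

(** * Arithmetic, connectives and bounded quantifiers *)

Section Arith.
Implicit Types f g b a : seq nat -> nat.

Lemma rc_add f g : rc f -> rc g -> rc (fun e => f e + g e).
Proof.
apply: rc_app2; apply: rc_ext (rc_iteri (g := fun _ r _ => r.+1) (rc_var 0)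
  (rc_var 1) _) => [e|].
  by elim: (nth 0 e 0) => //= n ->; rewrite addSn.
by apply: rc_succ; rcvar.
Qed.

Lemma rc_mul f g : rc f -> rc g -> rc (fun e => f e * g e).
Proof.
apply: rc_app2.
apply: rc_ext (rc_iteri (g := fun _ r e => nth 0 e 1 + r) (rc_var 0) (rc_const
  0) _) => [e|].
  by elim: (nth 0 e 0) => //= n ->; rewrite mulSn.
by apply: rc_add; rcvar.
Qed.

Lemma rc_exp f g : rc f -> rc g -> rc (fun e => f e ^ g e).
Proof.
apply: rc_app2.
apply: rc_ext (rc_iteri (g := fun _ r e => nth 0 e 0 * r) (rc_var 1) (rc_const
  1) _) => [e|].
  by elim: (nth 0 e 1) => //= n ->; rewrite expnS.
by apply: rc_mul; rcvar.
Qed.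

Lemma rc_pred f : rc f -> rc (fun e => (f e).-1).
Proof.
apply: (rc_app1 (F := predn)).
apply: rc_ext (rc_iteri (g := fun k _ _ => k) (rc_var 0) (rc_const 0) _) => [e|].
  by case: (nth 0 e 0).
by rcvar.
Qed.

Lemma rc_sub f g : rc f -> rc g -> rc (fun e => f e - g e).
Proof.
apply: rc_app2.
apply: rc_ext (rc_iteri (g := fun _ r e => r.-1) (rc_var 1) (rc_var 0) _) => [e|].
  by elim: (nth 0 e 1) => /= [|n ->]; rewrite ?subn0 ?subnS.
by apply: rc_pred; rcvar.
Qed.

Lemma rc_not (p : seq nat -> bool) : rc p -> rc (fun e => ~~ p e).
Proof.
by move=> rp; apply: rc_ext (rc_sub (rc_const 1) rp) => e; case: (p e).
Qed.

Lemma rc_and (p q : seq nat -> bool) : rc p -> rc q -> rc (fun e => p e && q e).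
Proof. by move=> rp rq; apply: rc_ext (rc_mul rp rq) => e; rewrite mulnb. Qed.

Lemma rc_or (p q : seq nat -> bool) : rc p -> rc q -> rc (fun e => p e || q e).
Proof.
move=> rp rq; apply: rc_ext (rc_not (rc_and (rc_not rp) (rc_not rq))) => e.
by rewrite negb_and !negbK.
Qed.

Lemma rc_imply (p q : seq nat -> bool) : rc p -> rc q -> rc (fun e => p e ==> q e).
Proof.
by move=> rp rq; apply: rc_ext (rc_or (rc_not rp) rq) => e; rewrite implybE.
Qed.

Lemma rc_leq f g : rc f -> rc g -> rc (fun e => f e <= g e).
Proof.
move=> rf rg; apply: rc_ext (rc_sub (rc_const 1) (rc_sub rf rg)) => e.
by rewrite /leq; case: (f e - g e).
Qed.

Lemma rc_eq f g : rc f -> rc g -> rc (fun e => f e == g e).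
Proof.
move=> rf rg; apply: rc_ext (rc_and (rc_leq rf rg) (rc_leq rg rf)) => e.
by rewrite eqn_leq.
Qed.

Lemma rc_eqb (p q : seq nat -> bool) : rc p -> rc q -> rc (fun e => p e == q e).
Proof.
by move=> rp rq; apply: rc_ext (rc_eq rp rq) => e; do 2!case: (_ e).
Qed.

Lemma rc_if (p : seq nat -> bool) f g : rc p -> rc f -> rc g ->
  rc (fun e => if p e then f e else g e).
Proof.
move=> rp rf rg; apply: rc_ext (rc_add (rc_mul rp rf) (rc_mul (rc_not rp) rg)) => e.
by case: (p e); rewrite ?mul1n ?mul0n ?addn0.
Qed.

Lemma iota0S n : iota 0 n.+1 = iota 0 n ++ [:: n].
Proof. by rewrite -addn1 iotaD. Qed.

(** Bounded quantifiers, division and decoding all reduce to bounded counting. *)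
Lemma rc_count b (P : nat -> seq nat -> bool) : rc b ->
  rc (fun e => P (nth 0 e 0) (drop 2 e)) ->
  rc (fun e => count (fun k => P k e) (iota 0 (b e))).
Proof.
move=> rb rP.
apply: rc_ext (rc_iteri (g := fun k r e => r + P k e) rb (rc_const 0) _) => [e|].
  by elim: (b e) => // n IH; rewrite iota0S count_cat -IH /= addn0.
by apply: rc_add => //; rcvar.
Qed.

Lemma rc_has b (P : nat -> seq nat -> bool) : rc b ->
  rc (fun e => P (nth 0 e 0) (drop 2 e)) ->
  rc (fun e => has (fun k => P k e) (iota 0 (b e))).
Proof.
move=> rb rP; apply: rc_ext (rc_leq (rc_const 1) (rc_count rb rP)) => e.
by rewrite has_count.
Qed.

Lemma rc_all b (P : nat -> seq nat -> bool) : rc b ->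
  rc (fun e => P (nth 0 e 0) (drop 2 e)) ->
  rc (fun e => all (fun k => P k e) (iota 0 (b e))).
Proof.
move=> rb rP; apply: rc_ext (rc_eq (rc_count rb rP) rb) => e.
by rewrite all_count size_iota.
Qed.

Lemma count_ltn_iota (a n : nat) : a <= n -> count (fun k => k < a) (iota 0 n) = a.
Proof.
move=> an; rewrite -(subnKC an) iotaD count_cat.
rewrite [X in X + _](eq_in_count (a2 := predT)) => [|k]; last first.
  by rewrite mem_iota => /andP[_ ->].
rewrite [X in _ + X](eq_in_count (a2 := pred0)) => [|k].
  by rewrite count_predT size_iota count_pred0 addn0.
by rewrite mem_iota => /andP[ak _]; rewrite ltnNge ak.
Qed.

(** The quotient of [m] by [d] counts the [k] with [k.+1 * d <= m]; the guard [0 < d] makes division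
    by zero return 0. *)
Lemma rc_div f g : rc f -> rc g -> rc (fun e => f e %/ g e).
Proof.
apply: rc_app2.
pose P k e := (0 < nth 0 e 1) && (k.+1 * nth 0 e 1 <= nth 0 e 0).
apply: rc_ext (rc_count (P := P) (rc_var 0) _) => [e|]; last first.
  apply: rc_and; apply: rc_leq; try apply: rc_mul; try apply: rc_succ; rcvar.
rewrite {}/P; set m := nth 0 e 0; set d := nth 0 e 1.
case: (posnP d) => [->|d0]; first by rewrite divn0 count_pred0.
rewrite (eq_count (a2 := fun k => k < m %/ d)) => [|k]; last by rewrite /= leq_divRL.
exact: count_ltn_iota (leq_div m d).
Qed.

Lemma rc_mod f g : rc f -> rc g -> rc (fun e => f e %% g e).
Proof.
move=> rf rg; apply: rc_ext (rc_sub rf (rc_mul (rc_div rf rg) rg)) => e.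
by rewrite {1}(divn_eq (f e) (g e)) addKn.
Qed.

Lemma rc_dvd f g : rc f -> rc g -> rc (fun e => f e %| g e).
Proof.
move=> rf rg.
by apply: rc_ext (rc_eq (rc_mod rg rf) (rc_const 0)) => e; rewrite /dvdn.
Qed.
End Arith.

Ltac rcstep := first [ rcvar | match goal with
  | |- rc (fun e => S _) => apply: rc_succ
  | |- rc (fun e => addn _ _) => apply: rc_add
  | |- rc (fun e => muln _ _) => apply: rc_mul
  | |- rc (fun e => expn _ _) => apply: rc_exp
  | |- rc (fun e => subn _ _) => apply: rc_sub
  | |- rc (fun e => divn _ _) => apply: rc_div
  | |- rc (fun e => modn _ _) => apply: rc_mod
  | |- rc (fun e => nat_of_bool (~~ _)) => apply: rc_not
  | |- rc (fun e => nat_of_bool (_ && _)) => apply: rc_and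
  | |- rc (fun e => nat_of_bool (_ || _)) => apply: rc_or
  | |- rc (fun e => nat_of_bool (_ ==> _)) => apply: rc_imply
  | |- rc (fun e => nat_of_bool (_ == _)) => first [apply: rc_eqb | apply: rc_eq]
  | |- rc (fun e => nat_of_bool (leq _ _)) => apply: rc_leq
  | |- rc (fun e => nat_of_bool (dvdn _ _)) => apply: rc_dvd
  | |- rc (fun e => nat_of_bool (has _ _)) => apply: rc_has
  | |- rc (fun e => nat_of_bool (all _ _)) => apply: rc_all
  | |- rc (fun e => count _ _) => apply: rc_count
  | |- rc (fun e => iteri _ _ _) => apply: rc_iteri
  | |- rc (fun e => if _ then _ else _) => apply: rc_if
  end ].
Ltac rcs := repeat rcstep.

(** * Codes of sequences, sets, maps and graphs *)

(** The code of [a :: l] is an odd multiple of [2 ^ a], so the head is the 2-adic valuation. On 0,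
    the code of the empty list, it returns the default 0. *)
Definition hdc x := count (fun k => 2 ^ k.+1 %| x) (iota 0 x).

Lemma rec_hdc : rec1 hdc.
Proof. by rewrite /rec1 /hdc; rcs. Qed.

Definition tlc x := x %/ 2 ^ (hdc x).+1.

Lemma rec_tlc : rec1 tlc.
Proof. by rewrite /rec1 /tlc; rcs; apply: (rc_app1 rec_hdc); rcs. Qed.

Definition dropc i x := iteri i (fun _ r => tlc r) x.

Lemma rec_dropc : rec2 dropc.
Proof. by rewrite /rec2 /dropc; rcs; apply: (rc_app1 rec_tlc); rcs. Qed.

Definition nthc x i := hdc (dropc i x).

Lemma rec_nthc : rec2 nthc.
Proof. by apply: (rc_app1 rec_hdc); apply: (rc_app2 rec_dropc); rcs. Qed.

(** Only the empty list has code 0, and a code is at least the length of its list, so counting below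
    [x] is enough. *)
Definition sizec x := count (fun k => dropc k x != 0) (iota 0 x).

Lemma rec_sizec : rec1 sizec.
Proof. rewrite /rec1 /sizec; rcs; apply: (rc_app2 rec_dropc); rcs. Qed.

Definition tbl x i j := nthc (nthc x i) j.

Lemma rec_tbl : rec3 tbl.
Proof. by do 2!(apply: (rc_app2 rec_nthc); rcs). Qed.

Definition digit s x i := x %/ s ^ i %% s.

Lemma rec_digit : rec3 digit.
Proof. by rewrite /rec3 /digit; rcs. Qed.

Definition bit m i := digit 2 m i == 1.

Lemma rec_bit : rec2 (fun m i => bit m i).
Proof. by rewrite /rec2 /bit; rcs; apply: (rc_app3 rec_digit); rcs. Qed.

(** [m] is read as an [n] by [n] bit matrix, symmetrised and with its diagonal ignored, so every
    number codes a graph. *)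
Definition adjc n m i j := (i != j) && (bit m (i * n + j) || bit m (j * n + i)).

Lemma rec_adjc : rec4 (fun n m i j => adjc n m i j).
Proof. by rewrite /rec4 /adjc; rcs; apply: (rc_app2 rec_bit); rcs. Qed.

Ltac rcs_codes := repeat first [ rcstep | match goal with
  | |- rc (fun e => digit _ _ _) => apply: (rc_app3 rec_digit)
  | |- rc (fun e => nat_of_bool (bit _ _)) => apply: (rc_app2 rec_bit)
  | |- rc (fun e => nat_of_bool (adjc _ _ _ _)) => apply: (rc_app4 rec_adjc)
  | |- rc (fun e => tbl _ _ _) => apply: (rc_app3 rec_tbl)
  | |- rc (fun e => sizec _) => apply: (rc_app1 rec_sizec)
  end ].

Definition connc n m U :=
  all (fun W =>
    all (fun i => all (fun j =>
      [&& bit U i, bit U j & adjc n m i j] ==> (bit W i == bit W j)) (iota 0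
        n)) (iota 0 n)
    ==> all (fun i => all (fun j =>
      bit U i && bit U j ==> (bit W i == bit W j)) (iota 0 n)) (iota 0 n))
    (iota 0 (2 ^ n)).

Lemma rec_connc : rec3 (fun n m U => connc n m U).
Proof. by rewrite /rec3 /connc; rcs_codes. Qed.

(** [z] is meant as the position of the group's zero; the labels are digits of [l], read as
    positions in the table. *)
Definition sumc x n l U z :=
  iteri n (fun i r => if bit U i then tbl x r (digit (sizec x) l i) else r) z.

(* [z] ranges over the idempotents of the table: only the zero of the group. *)
Definition zavoidc x n m l D :=
  all (fun U =>
    [&& all (fun i => bit U i ==> bit D i) (iota 0 n), has (bit U) (iota 0 n) &
      connc n m U]
    ==> all (fun z => (tbl x z z == z) ==> (sumc x n l U z != z)) (iota 0 (sizec x)))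
    (iota 0 (2 ^ n)).

Lemma rec_zavoidc : rec5 (fun x n m l D => zavoidc x n m l D).
Proof.
by rewrite /rec5 /zavoidc /sumc; rcs_codes; apply: (rc_app3 rec_connc); rcs_codes.
Qed.

(** One equivalence per [D] covers both clauses: the full set has no avoiding labelling, every
    proper subset has one. *)
Definition minimalc x n m :=
  all (fun D => all (bit D) (iota 0 n) ==
    ~~ has (fun l => zavoidc x n m l D) (iota 0 (sizec x ^ n))) (iota 0 (2 ^ n)).

Lemma rec_minimalc : rec3 (fun x n m => minimalc x n m).
Proof. by rewrite /rec3 /minimalc; rcs_codes; apply: (rc_app5 rec_zavoidc);
  rcs_codes. Qed.

(** A map is a string of base [n] digits; injectivity suffices between sets of equal size. *)
Definition isoc n m m' :=
  has (fun f =>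
    all (fun i => all (fun j =>
      ((digit n f i == digit n f j) ==> (i == j)) &&
      (adjc n m' (digit n f i) (digit n f j) == adjc n m i j))
      (iota 0 n)) (iota 0 n))
    (iota 0 (n ^ n)).

Lemma rec_isoc : rec3 (fun n m m' => isoc n m m').
Proof. by rewrite /rec3 /isoc; rcs_codes. Qed.

(** Keeping only the least code of each isomorphism class prevents repetitions. *)
Definition goodc x n m :=
  [&& m < 2 ^ (n * n), minimalc x n m & ~~ has (fun m' => isoc n m' m) (iota 0 m)].

Lemma rec_goodc : rec3 (fun x n m => goodc x n m).
Proof.
rewrite /rec3 /goodc; rcs_codes; first by apply: (rc_app3 rec_minimalc); rcs_codes.
by apply: (rc_app3 rec_isoc); rcs_codes.
Qed.

Definition consc a x := 2 ^ a * x.*2.+1.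

Lemma rc_consc f g : rc f -> rc g -> rc (fun e => consc (f e) (g e)).
Proof.
move=> rf rg; apply: (rc_ext (f := fun e => 2 ^ f e * (2 * g e).+1)) => [e|].
  by rewrite mul2n.
by rcs.
Qed.

(** The last iteration conses outermost, hence the reversed enumerations. *)
Lemma iteri_consc b (P : pred nat) F :
  iteri b (fun k r => if P k then consc (F k) r else r) 0 =
  CodeSeq.code [seq F k | k <- rev (iota 0 b) & P k].
Proof.
elim: b => // b IH; rewrite iota0S rev_cat /= IH; by case: ifP.
Qed.

Definition edges n m : seq (nat * nat) :=
  [seq (p %/ n, p %% n) | p <- rev (iota 0 (n * n)) & bit m p].

Definition edgesc n m :=
  iteri (n * n) (fun p r =>
    if bit m p then consc (consc (p %/ n) (consc (p %% n) 0)) r else r) 0.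

Lemma edgescE n m : edgesc n m = pickle (edges n m).
Proof. by rewrite /edgesc (iteri_consc _ (bit m)) [RHS]/pickle /= /pickle_seq
  -map_comp. Qed.

Lemma rec_edgesc : rec2 edgesc.
Proof. by rewrite /rec2 /edgesc; rcs_codes; do ?[apply: rc_consc; rcs_codes]. Qed.

Lemma rec_size_bound : rec1 size_bound.
Proof. by rewrite /rec1 /size_bound /components_bound; rcs. Qed.

(* [p] stands for the graph of order [p %% K] coded by [p %/ K]. *)
Definition forcing_graphs (t : seq (seq nat)) : seq graph_data :=
  let x := pickle t in let K := (size_bound (sizec x)).+1 in
  [seq (p %% K, edges (p %% K) (p %/ K)) |
    p <- rev (iota 0 (K * 2 ^ (K * K))) & goodc x (p %% K) (p %/ K)].

Definition forcing_graphsc x :=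
  let K := (size_bound (sizec x)).+1 in
  iteri (K * 2 ^ (K * K)) (fun p r =>
    if goodc x (p %% K) (p %/ K) then
      consc (consc (p %% K) (consc (edgesc (p %% K) (p %/ K)) 0)) r else r) 0.

Lemma rec_forcing_graphsc : rec1 forcing_graphsc.
Proof.
have rK e0 : rc e0 -> rc (fun e => size_bound (sizec (e0 e))).
  by move=> re0; apply/(rc_app1 rec_size_bound)/(rc_app1 rec_sizec).
rewrite /rec1 /forcing_graphsc /=; apply: rc_iteri.
- by rcs; apply: rK; rcvar.
- by rcvar.
apply: rc_if; last by rcvar.
  by apply: (rc_app3 rec_goodc); first rcvar; rcs; apply: rK; rcvar.
apply: rc_consc; last by rcvar.
apply: rc_consc; first by rcs; apply: rK; rcvar.
by apply: rc_consc; last rcvar; apply: (rc_app2 rec_edgesc); rcs; apply: rK; rcvar.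
Qed.

Lemma rec1_computable f : rec1 f -> @recursive 1 (fun v => f (thead v)).
Proof.
by move=> rf; apply: rec_ext (rf 1) => v; rewrite /thead (tnth_nth 0).
Qed.

Lemma computable_forcing_graphs : computable forcing_graphs.
Proof.
exists forcing_graphsc; split; first exact/rec1_computable/rec_forcing_graphsc.
move=> t; rewrite /forcing_graphsc /=; set x := pickle t; set K := _.+1.
rewrite (iteri_consc _ (fun p => goodc x (p %% K) (p %/ K))).
rewrite [RHS]/pickle /= /pickle_seq /forcing_graphs /= -/x -/K -map_comp.
congr CodeSeq.code; apply: eq_map => p /=; rewrite edgescE.
reflexivity.
Qed.

Lemma computable_size_bound : computable size_bound.
Proof.
by exists size_bound; split=> //; apply/rec1_computable/rec_size_bound.
Qed.

(** * Correctness of the search *)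

Section Codes.
Local Notation code := CodeSeq.code.

Lemma hdc_code a l : hdc (code (a :: l)) = a.
Proof.
rewrite /hdc (eq_count (a2 := fun k => k < a)) => [|k].
  apply: count_ltn_iota; apply: leq_trans (ltnW (ltn_expl a (isT : 1 < 2))) _.
  by rewrite leq_pmulr.
rewrite [code _]/=; have [ka|ak] := ltnP k a; first by rewrite dvdn_mulr ?dvdn_exp2l.
apply/negP=> /(dvdn_trans (dvdn_exp2l 2 (ak : a.+1 <= k.+1))).
by rewrite expnSr dvdn_pmul2l ?expn_gt0 // dvdn2 /= odd_double.
Qed.

Lemma tlc_code a l : tlc (code (a :: l)) = code l.
Proof.
rewrite /tlc hdc_code [code _]/= expnSr divnMl ?expn_gt0 //.
by rewrite -addn1 -muln2 divnMDl // addn0.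
Qed.

Lemma dropc_code i l : dropc i (code l) = code (drop i l).
Proof.
elim: i => [|i IH]; first by rewrite drop0.
rewrite /dropc iteriS -/(dropc i _) IH -addn1 addnC -drop_drop.
by case: (drop i l) => // a l'; rewrite tlc_code /= drop0.
Qed.

Lemma nthc_code l i : nthc (code l) i = nth 0 l i.
Proof.
rewrite /nthc dropc_code -[i in RHS]addn0 -nth_drop.
by case: (drop i l) => // a l'; rewrite hdc_code.
Qed.

Lemma code_eq0 l : (code l == 0) = (l == [::]).
Proof. by case: l => // a l; rewrite /= muln_eq0 expn_eq0. Qed.

Lemma size_code l : size l <= code l.
Proof.
elim: l => // a l IH; rewrite /= -(mul1n (size l).+1) leq_mul ?expn_gt0 //.
by rewrite ltnS (leq_trans IH) // -addnn leq_addr.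
Qed.

Lemma sizec_code l : sizec (code l) = size l.
Proof.
rewrite /sizec (eq_count (a2 := fun k => k < size l)) => [|k].
  exact: count_ltn_iota (size_code l).
by rewrite dropc_code code_eq0 -size_eq0 size_drop subn_eq0 -ltnNge.
Qed.

Lemma sizec_pickle (t : seq (seq nat)) : sizec (pickle t) = size t.
Proof. by rewrite [pickle t]/(code (map pickle t)) sizec_code size_map. Qed.

Lemma tbl_pickle (t : seq (seq nat)) i j : tbl (pickle t) i j = nth 0 (nth [::]
  t i) j.
Proof.
rewrite /tbl [pickle t]/(code (map pickle t)) nthc_code.
have -> : nth 0 (map pickle t) i = code (nth [::] t i).
  have [it|ti] := ltnP i (size t); last by rewrite !nth_default ?size_map.
  by rewrite (nth_map [::]) // [pickle _]/(code (map id _)) map_id.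
exact: nthc_code.
Qed.
End Codes.

(** * Digit expansions and bit sets *)

Section Digits.

Lemma digit0 s x : digit s x 0 = x %% s.
Proof. by rewrite /digit expn0 divn1. Qed.

Lemma digitS s x i : digit s x i.+1 = digit s (x %/ s) i.
Proof. by rewrite /digit expnS divnMA. Qed.

Lemma digit_lt s x i : 0 < s -> digit s x i < s.
Proof. exact: ltn_pmod. Qed.

Lemma ex_digits s n (f : nat -> nat) : (forall i, i < n -> f i < s) ->
  exists2 x, x < s ^ n & forall i, i < n -> digit s x i = f i.
Proof.
elim: n f => [|n IH] f fs; first by exists 0.
have [i ltin|x xs xE] := IH (fun i => f i.+1); first exact: fs.
have f0 : f 0 < s by apply: fs.
exists (x * s + f 0) => [|[|i] ltin].
- rewrite expnSr; apply: (@leq_trans (x.+1 * s)); last by rewrite leq_mul2r xs orbT.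
  by rewrite mulSn addnC ltn_add2r.
- by rewrite digit0 modnMDl modn_small.
by rewrite digitS divnMDl ?(leq_ltn_trans _ f0) // divn_small // addn0 xE.
Qed.

Lemma ex_bits n (P : pred nat) :
  exists2 m, m < 2 ^ n & forall i, i < n -> bit m i = P i.
Proof.
have [i _|m ms mE] := @ex_digits 2 n (fun i => P i); first by case: (P i).
by exists m => // i ltin; rewrite /bit mE //; case: (P i).
Qed.
End Digits.

Section Iota.
Variables (n : nat) (P : pred nat).

Lemma all_ordP : reflect (forall i : 'I_n, P i) (all P (iota 0 n)).
Proof.
apply: (iffP allP) => [H i|H i]; first by apply: H; rewrite mem_iota /= ltn_ord.
by rewrite mem_iota /= add0n => lti; apply: (H (Ordinal lti)).
Qed.

Lemma has_ordP : reflect (exists i : 'I_n, P i) (has P (iota 0 n)).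
Proof.
apply: (iffP hasP) => [[i]|[i Pi]].
  by rewrite mem_iota /= add0n => lti Pi; exists (Ordinal lti).
by exists (val i); rewrite // mem_iota /= ltn_ord.
Qed.

Definition bitset U : {set 'I_n} := [set i : 'I_n | bit U i].

Lemma ex_bitset (S : {set 'I_n}) : exists2 U, U < 2 ^ n & bitset U = S.
Proof.
have [U Un UE] := ex_bits n (fun k => if insub k is Some i then i \in S else false).
by exists U => //; apply/setP=> i; rewrite inE UE // valK.
Qed.

End Iota.

(** Every subset has a code below [2 ^ n], which turns quantification over sets into a bounded
    one. *)
Lemma all_bitsetP n (P : pred nat) (Q : {set 'I_n} -> Prop) :
  (forall U, reflect (Q (bitset n U)) (P U)) ->
  reflect (forall S, Q S) (all P (iota 0 (2 ^ n))).
Proof.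
move=> PQ; apply: (iffP allP) => [H S|H U _]; last exact/PQ.
by have [U ltU <-] := ex_bitset S; apply/PQ/H; rewrite mem_iota.
Qed.

(** * Coded graphs and their connected sets *)

Section GraphCode.
Variables (n m : nat).

Definition code_graph := graph_of_data (n, edges n m).

Lemma mem_edges (i j : 'I_n) : ((i : nat, j : nat) \in edges n m) = bit m (i * n + j).
Proof.
have n0 : 0 < n := leq_ltn_trans (leq0n i) (ltn_ord i).
apply/mapP/idP=> [[p /[!mem_filter]/andP[bp _] [-> ->]]|bm];
  first by rewrite -divn_eq.
exists (i * n + j); last by rewrite divnMDl // divn_small // addn0 modnMDl modn_small.
rewrite mem_filter bm mem_rev mem_iota /= add0n; apply: (@leq_trans (i.+1 * n)).
  by rewrite mulSn addnC ltn_add2r.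
by rewrite leq_mul2r ltn_ord orbT.
Qed.

Lemma adjcE (i j : 'I_n) : adjc n m i j = @adj code_graph i j.
Proof. by rewrite /= /data_adj /= !mem_edges. Qed.

Lemma conncE U : connc n m U = conn (bitset n U : {set code_graph}).
Proof.
pose Q (W : {set code_graph}) :=
  {in bitset n U &, forall i j, adj i j -> (i \in W) = (j \in W)} ->
  {in bitset n U &, forall i j, (i \in W) = (j \in W)}.
rewrite /connc; set P := (X in all X (iota 0 (2 ^ n))).
suff PQ W : reflect (Q (bitset n W)) (P W).
  exact: sameP (all_bitsetP PQ) (connP (bitset n U : {set code_graph})).
apply: (iffP implyP) => H inv.
  have /H/all_ordP {}H : all (fun i => all (fun j =>
      [&& bit U i, bit U j & adjc n m i j] ==> (bit W i == bit W j))
      (iota 0 n)) (iota 0 n).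
    apply/all_ordP=> a; apply/all_ordP=> b; apply/implyP=> /and3P[Ua Ub ab].
    by have := inv a b; rewrite !inE => ->; rewrite // -adjcE.
  move=> i j; rewrite !inE => Ui Uj.
  by have /all_ordP/(_ j)/implyP := H i; rewrite Ui Uj => /(_ isT)/eqP.
apply/all_ordP=> i; apply/all_ordP=> j; apply/implyP=> /andP[Ui Uj].
have := H _ i j; rewrite !inE => ->; rewrite // => a b; rewrite !inE => Ua Ub ab.
move/all_ordP: inv => inv.
by have /all_ordP/(_ b)/implyP := inv a; rewrite Ua Ub adjcE => /(_ ab)/eqP.
Qed.

End GraphCode.

(** * Addition tables and coded labellings *)

Section GroupCode.
Variables (A : finZmodType) (s : seq A).
Hypotheses (us : uniq s) (sT : forall x : A, x \in s).
Let x := pickle (cayley_table s).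
Local Open Scope ring_scope.

Lemma size_enum : size s = #|A|.
Proof.
by rewrite -(card_uniqP us); apply: eq_card => y; rewrite sT.
Qed.

Lemma sizec_cayley : sizec x = size s.
Proof. by rewrite sizec_pickle size_map. Qed.

Lemma size_enum_gt0 : (0 < size s)%N.
Proof. by have := sT 0; case: (s). Qed.

Lemma tbl_cayley a b : tbl x (index a s) (index b s) = index (a + b) s.
Proof.
rewrite tbl_pickle (nth_map 0) ?index_mem // (nth_map 0) ?index_mem //.
by rewrite !nth_index.
Qed.

Definition label n l : {ffun 'I_n -> A} := [ffun i : 'I_n => nth 0 s (digit
  (size s) l i)].

Lemma ex_label n (f : {ffun 'I_n -> A}) :
  exists2 l, (l < size s ^ n)%N & label n l = f.
Proof.
have [i _|l ln lE] := @ex_digits (size s) n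
  (fun k => if insub k is Some i then index (f i) s else 0%N).
  by case: insubP => [j _ _|_]; rewrite ?index_mem ?size_enum_gt0.
by exists l => //; apply/ffunP=> i; rewrite ffunE lE // valK nth_index.
Qed.

Lemma sumcE n l U :
  sumc x n l U (index 0 s) = index (\sum_(i in bitset n U) label n l i) s.
Proof.
transitivity (index (\sum_(i < n | bit U i) nth 0 s (digit (size s) l i)) s).
  rewrite /sumc sizec_cayley big_mkcond /=.
  elim: n => [|n IH]; first by rewrite big_ord0.
  rewrite iteriS IH big_ord_recr /=; case: ifP; rewrite ?addr0 // => _.
  have dn : (digit (size s) l n < size s)%N := digit_lt l n size_enum_gt0.
  by rewrite -{1}(index_uniq 0 dn us) tbl_cayley.
by congr (index _ s); apply: eq_big => i; rewrite ?inE // => _; rewrite ffunE.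
Qed.

(** By cancellation [a + a = a] forces [a = 0], so the table alone reveals the position of zero. *)
Lemma idempotentE z : (z < size s)%N -> (tbl x z z == z) = (z == index 0 s).
Proof.
move=> zs; have [a ->] : exists a, z = index a s.
  by exists (nth 0 s z); rewrite index_uniq.
rewrite tbl_cayley; apply/eqP/eqP=> /(congr1 (nth 0 s)); rewrite !nth_index //.
  by move/eqP; rewrite -subr_eq0 addrK => /eqP->.
by move->; rewrite addr0.
Qed.

Section Avoid.
Variables n m : nat.
Let G := code_graph n m.

Lemma zavoidcE l D :
  zavoidc x n m l D = zavoid (label n l : {ffun G -> A}) (bitset n D).
Proof.
pose Q (S : {set G}) := S \subset bitset n D -> S != set0 -> conn S ->
  \sum_(i in S) (label n l : {ffun G -> A}) i <> 0.
rewrite /zavoidc; set P := (X in all X (iota 0 (2 ^ n))).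
suff PQ U : reflect (Q (bitset n U)) (P U).
  exact: (sameP (all_bitsetP PQ) (zavoidP (label n l : {ffun G -> A}) (bitset n D))).
have subE : all (fun i => bit U i ==> bit D i) (iota 0 n) = (bitset n U \subset
  bitset n D).
  apply/all_ordP/subsetP=> H i; first by rewrite !inE; apply/implyP/H.
  by apply/implyP; have := H i; rewrite !inE.
have neqE : has (bit U) (iota 0 n) = (bitset n U != set0).
  by apply/has_ordP/set0Pn=> -[i]; exists i; rewrite inE in p *.
rewrite /P subE neqE conncE sizec_cayley.
suff -> : all (fun z => (tbl x z z == z) ==> (sumc x n l U z != z)) (iota 0 (size s))
        = (\sum_(i in bitset n U) label n l i != 0).
  apply: (iffP implyP) => H => [US U0 cU | /and3P[US U0 cU]]; apply/eqP;
    last exact: H.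
  by apply: H; rewrite US U0.
apply/allP/idP=> [H | sum0 z]; last first.
  rewrite mem_iota => /andP[_ zs]; rewrite idempotentE //; apply/implyP=> /eqP->.
  rewrite sumcE; apply: contra_neq sum0 => /(congr1 (nth 0 s)).
  by rewrite !nth_index.
have i0 : index 0 s \in iota 0 (size s) by rewrite mem_iota index_mem sT.
have /implyP := H _ i0; rewrite idempotentE ?index_mem // eqxx sumcE => /(_ isT).
by apply: contra_neq => ->.
Qed.

Lemma minimalcP : reflect (induced_minimal A G) (minimalc x n m).
Proof.
pose Q (D : {set G}) := (D == setT) = ~~ [exists l : {ffun G -> A}, zavoid l D].
have hasE D : has (fun l => zavoidc x n m l D) (iota 0 (sizec x ^ n))
    = [exists l : {ffun G -> A}, zavoid l (bitset n D)].
  apply/hasP/existsP=> [[l _]|[l]]; first by rewrite zavoidcE; exists (label n l).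
  have [k ks <-] := ex_label l; rewrite -zavoidcE sizec_cayley => H.
  by exists k => //; rewrite mem_iota.
have PQ D : reflect (Q (bitset n D)) (all (bit D) (iota 0 n) ==
    ~~ has (fun l => zavoidc x n m l D) (iota 0 (sizec x ^ n))).
  rewrite hasE /Q; have -> : all (bit D) (iota 0 n) = (bitset n D == setT).
    apply/all_ordP/eqP=> [H|/setP H i]; first by apply/setP=> i; rewrite !inE H.
    by have := H i; rewrite !inE.
  exact: eqP.
apply: (iffP (all_bitsetP PQ)) => [H|/induced_minimalP[zf mn] D].
  apply/induced_minimalP; split=> [l|D DT].
    by apply: contraTN isT => lT; have := H setT;
      rewrite /Q eqxx => /esym/existsPn/(_ l); rewrite lT.
  by apply/existsP; have := H D; rewrite /Q (negPf DT) => /esym/negbFE.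
rewrite /Q; have [->|DT] := eqVneq D setT.
  by apply/esym/existsPn.
by apply/esym/negbF/existsP/mn.
Qed.
End Avoid.

End GroupCode.

(** * Isomorphisms and their codes *)

Section Isomorphism.
Implicit Types G H K : sgraph.

Lemma isomorphic_sym G H : isomorphic G H -> isomorphic H G.
Proof.
case=> f [[g fK gK] fadj]; exists g; split; first by exists f.
by move=> x y; rewrite -fadj !gK.
Qed.

Lemma isomorphic_trans G H K : isomorphic G H -> isomorphic H K -> isomorphic G K.
Proof.
case=> f [fb fadj] [g [gb gadj]]; exists (g \o f); split; first exact: bij_comp.
by move=> x y; rewrite /= gadj fadj.
Qed.

Lemma isomorphic_card G H : isomorphic G H -> #|G| = #|H|.
Proof. by case=> f [fb _]; apply: bij_eq_card fb. Qed.

Lemma isomorphic_minimal A G H :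
  isomorphic G H -> induced_minimal A G -> induced_minimal A H.
Proof.
case=> f [[g fK gK] fadj] /induced_minimalP[zf mn]; apply/induced_minimalP.
have imE (D : {set H}) : D = f @: (f @^-1: D).
  apply/setP=> y; apply/idP/imsetP=> [yD|[x xD ->]]; last by rewrite inE in xD.
  by exists (g y); rewrite ?inE gK.
have avE l D := zavoid_imset (A := A) (can_inj fK) fadj l D.
split=> [l | D DT]; first by rewrite (imE setT) avE preimsetT.
have [|l avl] := mn (f @^-1: D).
  by apply: contra_neq DT => D'T; rewrite (imE D) D'T -(preimsetT f) -imE.
exists [ffun y => l (g y)]; rewrite (imE D) avE.
by apply: eq_zavoid avl => x _; rewrite !ffunE fK.
Qed.

Lemma isocP n m m' : reflect (isomorphic (code_graph n m) (code_graph n m'))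
  (isoc n m m').
Proof.
apply: (iffP hasP) => [[k _ /all_ordP kP]|[f [fb fadj]]].
  have dn (i : 'I_n) : digit n k i < n by rewrite digit_lt // (leq_ltn_trans _
    (ltn_ord i)).
  pose f (i : 'I_n) := Ordinal (dn i).
  have fP i j : ((f i == f j) ==> (i == j)) && (adjc n m' (f i) (f j) == adjc n
    m i j).
    by have /all_ordP/(_ j) := kP i.
  exists f; split=> [|i j]; last by have /andP[_ /eqP] := fP i j; rewrite !adjcE.
  by apply: injF_bij => i j ij; have /andP[/implyP] := fP i j;
    rewrite ij eqxx => /(_ isT)/eqP.
have [i lti|k kn kE] := @ex_digits n n (fun i => if insub i is Some j then val
  (f j) else 0).
  by rewrite insubT /= ltn_ord.
have {}kE (i : 'I_n) : digit n k i = f i by rewrite kE // valK.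
exists k; first by rewrite mem_iota.
apply/all_ordP=> i; apply/all_ordP=> j; rewrite !kE !adjcE fadj eqxx andbT.
by apply/implyP=> /eqP/val_inj/(bij_inj fb)->.
Qed.

(** The code is the adjacency matrix in the enumeration of the vertices, read as a bit string. *)
Lemma ex_code_graph G : exists2 m, m < 2 ^ (#|G| * #|G|) & isomorphic G
  (code_graph #|G| m).
Proof.
pose v : 'I_#|G| -> G := enum_val.
pose P p := match insub (p %/ #|G|), insub (p %% #|G|) with
  | Some i, Some j => adj (v i) (v j) | _, _ => false end.
have [m mG mP] := ex_bits (#|G| * #|G|) P; exists m => //.
have bitE (i j : 'I_#|G|) : bit m (i * #|G| + j) = adj (v i) (v j).
  have G0 : 0 < #|G| := leq_ltn_trans (leq0n i) (ltn_ord i).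
  rewrite mP.
    by rewrite /P divnMDl // modnMDl divn_small // modn_small // addn0 !valK.
  apply: (@leq_trans (i.+1 * #|G|)); first by rewrite mulSn addnC ltn_add2r.
  by rewrite leq_mul2r ltn_ord orbT.
apply: isomorphic_sym; exists v; split.
  exact: enum_val_bij.
move=> i j; rewrite -[RHS]adjcE /adjc !bitE [adj (v j) _]adj_sym orbb.
have [/val_inj->|//] := eqVneq (val i) (val j); by rewrite adj_irr.
Qed.
End Isomorphism.

Theorem theorem5p2 :
  (exists N : nat -> nat, computable N /\
     forall (A : finZmodType) (G : sgraph),
       induced_minimal A G -> #|G| <= N #|A|) /\
  (exists Z : seq (seq nat) -> seq graph_data, computable Z /\
     forall (A : finZmodType) (s : seq A),
       uniq s -> (forall x : A, x \in s) ->
       lists_up_to_iso (Z (cayley_table s)) (induced_minimal A)).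
Proof.
split.
  exists size_bound; split; first exact: computable_size_bound.
  exact: induced_minimal_bound.
exists forcing_graphs; split; first exact: computable_forcing_graphs.
move=> A s us sT; rewrite /forcing_graphs /=.
set x := pickle _; set K := _.+1; set ps := filter _ _.
have psP p : p \in ps -> goodc x (p %% K) (p %/ K) by rewrite mem_filter => /andP[].
split=> [G | i j /andP[ij]].
  split=> [mG | [_ /mapP[p /psP/and3P[_ /(minimalcP us sT) mn _] ->]]]; last first.
    by move/isomorphic_sym/isomorphic_minimal; apply.
  have [m0 m0G Gm0] := ex_code_graph G.
  (* The least code isomorphic to [G] is the one that [goodc] accepts. *)
  have [|m /andP[mG' mm0] m_min] := ex_minnP (P := fun m => (m < 2 ^ (#|G| *
    #|G|)) && isoc #|G| m m0).
    by exists m0; rewrite m0G; apply/isocP; exists id; split=> //; exists id.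
  have Gm : isomorphic G (code_graph #|G| m).
    by apply: isomorphic_trans Gm0 _; apply/isomorphic_sym/isocP.
  have GK : #|G| < K.
    by rewrite ltnS /x sizec_cayley (size_enum us sT) induced_minimal_bound.
  (* Code and order are packed as [m * K + #|G|], which decodes because [#|G| < K]. *)
  exists (#|G|, edges #|G| m) => //; apply/mapP; exists (m * K + #|G|); last first.
    by rewrite modnMDl modn_small // divnMDl // divn_small // addn0.
  rewrite mem_filter modnMDl modn_small // divnMDl // divn_small // addn0.
  rewrite mem_rev mem_iota /= add0n; apply/andP; split.
    apply/and3P; split=> //; first by apply/(minimalcP us sT);
      apply: isomorphic_minimal mG.
    apply/hasPn=> m'; rewrite mem_iota /= add0n => m'm; apply/negP=> /isocP m'iso.
    have : (m' < 2 ^ (#|G| * #|G|)) && isoc #|G| m' m0.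
      rewrite (ltn_trans m'm mG') /=; apply/isocP.
      by apply: isomorphic_trans m'iso _; apply/isocP.
    by move/m_min; rewrite leqNgt m'm.
  apply: (@leq_trans (m.+1 * K)); first by rewrite mulSn addnC ltn_add2r.
  rewrite mulnC leq_mul2l; apply/orP; right; apply: leq_trans mG' _.
  by rewrite leq_exp2l // leq_mul // ltnW.
rewrite size_map => js; have ltis := ltn_trans ij js.
rewrite !(nth_map 0) //; set p := nth 0 ps i; set q := nth 0 ps j => iso.
have pq : p != q.
  by rewrite nth_uniq ?neq_ltn ?ij // filter_uniq // rev_uniq iota_uniq.
have := isomorphic_card iso; rewrite !card_ord /= => pqK.
have /and3P[_ _ /hasPn pc] : goodc x (p %% K) (p %/ K) by apply/psP/mem_nth.
have /and3P[_ _ /hasPn qc] : goodc x (q %% K) (q %/ K) by apply/psP/mem_nth.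
rewrite pqK in iso pc *.
(* The orders agree and each code is least in its class, so the codes agree too and [p = q],
   contradicting [pq]. *)
case: (ltngtP (p %/ K) (q %/ K)) => [lt|lt|E].
- have p_lt : p %/ K \in iota 0 (q %/ K) by rewrite mem_iota.
  by case/negP: (qc _ p_lt); apply/isocP.
- have q_lt : q %/ K \in iota 0 (p %/ K) by rewrite mem_iota.
  by case/negP: (pc _ q_lt); apply/isocP/isomorphic_sym.
by case/eqP: pq; rewrite (divn_eq p K) (divn_eq q K) E pqK.
Qed.
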